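(* Let $p$ and $q$ be positive integers. For every graph $G$ the following statements are equivalent: (i) $G$ is hereditary $(p,q)$-biclique-Helly; (ii) $G$ is $(p,q')$-biclique-Helly for each integer $q'\geq q$; (iii) $G$ is strong $(p,q)$-biclique-Helly; (iv) each family of $p+1$ maximal bicliques of $G$ is strong $(p,q)$-Helly; (v) $\varPhi_q(\mathcal B(G))$ is hereditary $p$-Helly; (vi) a biclique-matrix $B(G)$ of $G$ contains no incidence matrix of $\mathcal J_{p+1,q,s}$ as a submatrix for any $s\in\{0,\ldots,q-1\}$; (vii) for each $s\in\{0,\ldots,q-1\}$, each subset $U$ of $V(G)$ with $|U|=(p+1)(q-s)+s$, and each $p+1$ pairwise disjoint $(q-s)$-subsets $T_1,\ldots,T_{p+1}$ of $U$ such that $U-T_1,\ldots,U-T_{p+1}$ are bicliques of $G$, there is some $i\in\{1,\ldots,p+1\}$ and some $v\in T_i$ such that $(U-T_i)\cup\{v,w\}$ is a biclique for every vertex $w$ of $G$ such that $(U-T_i)\cup\{w\}$ is a biclique; (viii) $G$ contains no induced subgraph isomorphic to a $(p+1,q,s)$-biocular for any $s\in\{0,\ldots,q-1\}$.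
   Context: Graphs are finite, simple and undirected. A graph is complete bipartite if its vertex set can be partitioned into two (possibly empty) stable sets with every vertex of one adjacent to every vertex of the other (edgeless graphs count as complete bipartite); a biclique is a vertex set inducing a complete bipartite graph; maximal means inclusion-wise maximal. The core of a family of sets is the intersection of its members. A family is $(p,q)$-intersecting if every nonempty subfamily of at most $p$ members has core of cardinality at least $q$, and has the $(p,q)$-Helly property if every nonempty $(p,q)$-intersecting subfamily has core of cardinality at least $q$. A family $\mathcal F$ is strong $(p,q)$-Helly if for every nonempty $(p,q)$-intersecting subfamily $\mathcal F'$ there is a nonempty subfamily of at most $p$ members of $\mathcal F'$ with the same core as $\mathcal F'$. A graph is $(p,q)$-biclique-Helly if the family of its maximal bicliques has the $(p,q)$-Helly property, hereditary $(p,q)$-biclique-Helly if every induced subgraph is $(p,q)$-biclique-Helly, and strong $(p,q)$-biclique-Helly if the family of its maximal bicliques is strong $(p,q)$-Helly. A hypergraph is a finite vertex set $X$ with a finite family of nonempty subsets (edges) whose union is $X$; it is $p$-Helly if every nonempty subfamily of edges in which every at most $p$ members have nonempty common intersection has nonempty core; for $X'\subseteq X$ the subhypergraph induced by $X'$ has vertex set $X'$ and edges the nonempty intersections of edges with $X'$; a hypergraph is hereditary $p$-Helly if all its subhypergraphs are $p$-Helly. $\mathcal B(G)$ is the hypergraph with vertex set $V(G)$ whose edges are the maximal bicliques of $G$. For a hypergraph $\mathcal H$, $\varPhi_q(\mathcal H)$ is the hypergraph whose vertices are the $q$-subsets of $V(\mathcal H)$ contained in some edge and whose edges are, for each edge $E$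 with $|E|\ge q$, the set of all $q$-subsets of $E$. A biclique-matrix $B(G)$ is a $(0,1)$-matrix with one row per maximal biclique and one column per vertex, with a $1$ exactly when the biclique contains the vertex. For $s\in\{0,\ldots,q-1\}$, $\mathcal J_{p+1,q,s}$ is the hypergraph with vertex set $V$ of cardinality $(p+1)(q-s)+s$ and the $p+1$ edges $V-T_1,\ldots,V-T_{p+1}$, where $T_1,\ldots,T_{p+1}$ are pairwise disjoint $(q-s)$-subsets of $V$. Bioculars: if $(p,q)=(1,1)$, the $(2,1,0)$-bioculars are the graphs $\overline{P_3}$ (a single edge plus an isolated vertex) and $K_3$. If $(p,q)\neq(1,1)$ and $s\in\{0,\ldots,q-1\}$, a $(p+1,q,s)$-biocular is a graph whose vertex set is the union of disjoint sets $U$ and $W$, where $|U|=(p+1)(q-s)+s$ and $T_1,\ldots,T_{p+1}$ are pairwise disjoint $(q-s)$-subsets of $U$, such that either ($\beta_1$) $p\in\{1,2\}$, $W=\emptyset$, for each $i$ the set $U-T_i$ is a biclique but $(U-T_i)\cup\{v_i\}$ is not a biclique for each $v_i\in T_i$, and either $p=1$ or $s=0$; or ($\beta_2$) $p\ge 2$, $(p,q)\ne(2,1)$, $W=\{w_1,\ldots,w_{p+1}\}$, $U$ is a biclique, and for each $i$, $(U-T_i)\cup\{w_i\}$ is a biclique but $(U-T_i)\cup\{w_i,v_i\}$ is not a biclique for each $v_i\in T_i$ (the graph induced by $W$ is arbitrary). *)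

(* Defs.v *)
From mathcomp Require Import all_boot all_order all_algebra.

Set Implicit Arguments.
Unset Strict Implicit.
Unset Printing Implicit Defensive.

(* A family is a {set {set T}}, i.e. it has no repeated
   members. *)

Section Families.
Variable T : finType.
Implicit Types F : {set {set T}}.

(* Only used for nonempty F: core set0 is the whole type. *)
Definition core F : {set T} := \bigcap_(S in F) S.

Definition pq_intersecting (p q : nat) F : Prop :=
  forall F' : {set {set T}},
    F' \subset F -> F' != set0 -> #|F'| <= p -> q <= #|core F'|.

Definition pq_Helly (p q : nat) F : Prop :=
  forall F' : {set {set T}},
    F' \subset F -> F' != set0 -> pq_intersecting p q F' -> q <= #|core F'|.

Definition strong_pq_Helly (p q : nat) F : Prop :=
  forall F' : {set {set T}},
    F' \subset F -> F' != set0 -> pq_intersecting p q F' ->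
    exists F'' : {set {set T}},
      [/\ F'' \subset F', F'' != set0, #|F''| <= p & core F'' = core F'].

Definition pairwise_disjoint (k : nat) (T_ : 'I_k -> {set T}) : Prop :=
  forall i j, i != j -> [disjoint T_ i & T_ j].

(* M is an incidence matrix of the family F of subsets of X: rows and columns
   are in bijection with F and X, in an arbitrary order. *)
Definition incidence_matrix (X : {set T}) F (m n : nat) (M : 'M[nat]_(m, n))
    : Prop :=
  exists (r : 'I_m -> {set T}) (c : 'I_n -> T),
    [/\ injective r, injective c, [set r i | i in 'I_m] = F,
        [set c j | j in 'I_n] = X
      & forall i j, M i j = (c j \in r i)].

End Families.

Definition submatrix (k l m n : nat) (N : 'M[nat]_(k, l)) (M : 'M[nat]_(m, n))
    : Prop :=
  exists (f : 'I_k -> 'I_m) (g : 'I_l -> 'I_n),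
    [/\ {homo f : i j / i < j}, {homo g : i j / i < j} & N = mxsub f g M].

(* Hypergraphs whose vertices form a subset of an ambient finite type. *)

Record hypergraph (T : finType) := Hypergraph {
  hvert : {set T};
  hedges : {set {set T}};
  hedges_neq0 : set0 \notin hedges;
  hedges_cover : cover hedges = hvert
}.

Section Hypergraphs.
Variable T : finType.
Implicit Types H : hypergraph T.

Definition p_Helly (p : nat) H : Prop :=
  forall F : {set {set T}},
    F \subset hedges H -> F != set0 ->
    (forall F' : {set {set T}},
       F' \subset F -> F' != set0 -> #|F'| <= p -> core F' != set0) ->
    core F != set0.

Section Sub.
Variables (H : hypergraph T) (X : {set T}).
Hypothesis sXH : X \subset hvert H.

Definition sub_edges : {set {set T}} :=
  [set E :&: X | E in hedges H] :\ set0.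

Lemma sub_edges_neq0 : set0 \notin sub_edges.
Proof. by rewrite !inE eqxx. Qed.

Lemma sub_edges_cover : cover sub_edges = X.
Proof.
apply/setP=> x; apply/bigcupP/idP.
  by case=> _ /setD1P[_ /imsetP[E _ ->]] /setIP[].
move=> xX; have := subsetP sXH x xX; rewrite -hedges_cover.
case/bigcupP=> E HE xE; exists (E :&: X); last by rewrite inE xE.
apply/setD1P; split; last exact: imset_f.
by apply/set0Pn; exists x; rewrite inE xE.
Qed.

Definition subhypergraph : hypergraph T :=
  Hypergraph sub_edges_neq0 sub_edges_cover.

End Sub.

Definition hereditary_p_Helly (p : nat) H : Prop :=
  forall (X : {set T}) (sXH : X \subset hvert H), p_Helly p (subhypergraph sXH).

Section Phi.
Variables (q : nat) (H : hypergraph T).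

Definition Phi_vert : {set {set T}} :=
  [set S : {set T} | (#|S| == q) && [exists E in hedges H, S \subset E]].

Definition Phi_edges : {set {set {set T}}} :=
  [set [set S : {set T} | (S \subset E) && (#|S| == q)]
     | E : {set T} in hedges H & q <= #|E|].

Lemma Phi_edges_neq0 : set0 \notin Phi_edges.
Proof.
apply/imsetP=> -[E]; rewrite inE => /andP[_ leqE] E0.
have : 0 < #|[set S : {set T} | (S \subset E) && (#|S| == q)]|.
  by rewrite cards_draws bin_gt0.
by rewrite -E0 cards0.
Qed.

Lemma Phi_edges_cover : cover Phi_edges = Phi_vert.
Proof.
apply/setP=> S; rewrite inE; apply/bigcupP/andP.
  case=> _ /imsetP[E + ->]; rewrite !inE => /andP[HE _] /andP[sSE cS].
  by split=> //; apply/existsP; exists E; apply/andP.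
case=> cS /existsP[E /andP[HE sSE]].
exists [set S' : {set T} | (S' \subset E) && (#|S'| == q)]; last first.
  by rewrite inE sSE.
by apply: imset_f; rewrite inE HE -(eqP cS) subset_leq_card.
Qed.

Definition Phi : hypergraph {set T} :=
  Hypergraph Phi_edges_neq0 Phi_edges_cover.

End Phi.

(* H is (a copy of) the hypergraph J_{k,q,s}. *)
Definition is_J (k q s : nat) H : Prop :=
  #|hvert H| = k * (q - s) + s /\
  exists T_ : 'I_k -> {set T},
    [/\ forall i, T_ i \subset hvert H,
        forall i, #|T_ i| = q - s,
        pairwise_disjoint T_
      & hedges H = [set hvert H :\: T_ i | i in 'I_k]].

End Hypergraphs.

Record sgraph := SGraph {
  vertex :> finType;
  adj : rel vertex;
  adj_sym : symmetric adj;
  adj_irr : irreflexive adj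
}.

Definition sgraph_iso (G H : sgraph) : Prop :=
  exists f : G -> H, bijective f /\ forall x y, adj (f x) (f y) = adj x y.

Section Induced.
Variables (G : sgraph) (X : {set G}).

Definition induced_adj : rel {x : G | x \in X} :=
  fun x y => adj (val x) (val y).

Lemma induced_sym : symmetric induced_adj.
Proof. by move=> x y; apply: adj_sym. Qed.

Lemma induced_irr : irreflexive induced_adj.
Proof. by move=> x; apply: adj_irr. Qed.

Definition induced : sgraph := SGraph induced_sym induced_irr.

End Induced.

Section Complement.
Variable G : sgraph.

Definition compl_adj : rel G := fun x y => (x != y) && ~~ adj x y.

Lemma compl_sym : symmetric compl_adj.
Proof. by move=> x y; rewrite /compl_adj eq_sym adj_sym. Qed.

Lemma compl_irr : irreflexive compl_adj.
Proof. by move=> x; rewrite /compl_adj eqxx. Qed.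

Definition complement : sgraph := SGraph compl_sym compl_irr.

End Complement.

Section PathComplete.
Variable n : nat.

Definition path_adj : rel 'I_n := fun i j => (i.+1 == j) || (j.+1 == i).

Lemma path_sym : symmetric path_adj.
Proof. by move=> i j; apply: orbC. Qed.

Lemma path_irr : irreflexive path_adj.
Proof. by move=> i; rewrite /path_adj orbb gtn_eqF. Qed.

Definition path_graph : sgraph := SGraph path_sym path_irr.

Definition complete_adj : rel 'I_n := fun i j => i != j.

Lemma complete_sym : symmetric complete_adj.
Proof. by move=> i j; rewrite /complete_adj eq_sym. Qed.

Lemma complete_irr : irreflexive complete_adj.
Proof. by move=> i; rewrite /complete_adj eqxx. Qed.

Definition complete_graph : sgraph := SGraph complete_sym complete_irr.

End PathComplete.

Definition stable (G : sgraph) (A : {set G}) : bool :=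
  [forall x in A, forall y in A, ~~ adj x y].

Definition complete_bipartite (G : sgraph) : bool :=
  [exists A : {set G}, [&& stable A, stable (~: A)
                         & [forall x in A, forall y in ~: A, adj x y]]].

Definition biclique (G : sgraph) (S : {set G}) : bool :=
  complete_bipartite (induced S).

Definition max_bicliques (G : sgraph) : {set {set G}} :=
  [set S | maxset (@biclique G) S].

Definition biclique_Helly (p q : nat) (G : sgraph) : Prop :=
  pq_Helly p q (max_bicliques G).

Definition hereditary_biclique_Helly (p q : nat) (G : sgraph) : Prop :=
  forall X : {set G}, biclique_Helly p q (induced X).

Definition strong_biclique_Helly (p q : nat) (G : sgraph) : Prop :=
  strong_pq_Helly p q (max_bicliques G).

Definition biclique_matrix (G : sgraph) (m n : nat) (M : 'M[nat]_(m, n))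
    : Prop :=
  incidence_matrix [set: G] (max_bicliques G) M.

Lemma biclique_matrix_exists (G : sgraph) :
  exists M : 'M[nat]_(#|max_bicliques G|, #|G|), biclique_matrix G M.
Proof.
exists (\matrix_(i, j) ((enum_val j : G) \in (enum_val i : {set G}) : nat))%R.
exists enum_val, enum_val; split.
- exact: enum_val_inj.
- exact: enum_val_inj.
- apply/setP=> S; apply/imsetP/idP => [[i _ ->]|MS]; first exact: enum_valP.
  by exists (enum_rank_in MS S) => //; rewrite enum_rankK_in.
- apply/setP=> x; rewrite inE; apply/imsetP.
  by exists (enum_rank x) => //; rewrite enum_rankK.
- by move=> i j; rewrite mxE.
Qed.

Section BicliqueHypergraph.
Variable G : sgraph.

(* Removing set0 matters only for the graph without vertices, whose unique
   maximal biclique is empty. *)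
Definition biclique_edges : {set {set G}} := max_bicliques G :\ set0.

Lemma biclique_edges_neq0 : set0 \notin biclique_edges.
Proof. by rewrite !inE eqxx. Qed.

Lemma biclique1 (x : G) : biclique [set x].
Proof.
apply/existsP; exists setT; apply/and3P; split.
- apply/forall_inP=> -[y yx] _; apply/forall_inP=> -[z zx] _.
  by rewrite /= /induced_adj /= (set1P yx) (set1P zx) adj_irr.
- by apply/forall_inP=> y; rewrite !inE.
- by apply/forall_inP=> y _; apply/forall_inP=> z; rewrite !inE.
Qed.

Lemma biclique_edges_cover : cover biclique_edges = [set: G].
Proof.
apply/setP=> x; rewrite inE; apply/bigcupP.
have [S mS sxS] := maxset_exists (biclique1 x).
have xS : x \in S by rewrite (subsetP sxS) ?set11.
exists S => //; rewrite !inE mS andbT; apply/set0Pn; by exists x.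
Qed.

Definition biclique_hypergraph : hypergraph G :=
  Hypergraph biclique_edges_neq0 biclique_edges_cover.

End BicliqueHypergraph.

Section Bioculars.
Variables (p q s : nat) (H : sgraph).

Definition beta1 (U W : {set H}) (T_ : 'I_p.+1 -> {set H}) : Prop :=
  [/\ p = 1 \/ p = 2,
      W = set0,
      forall i, biclique (U :\: T_ i) /\
        (forall v, v \in T_ i -> ~~ biclique (v |: (U :\: T_ i)))
    & p = 1 \/ s = 0].

Definition beta2 (U W : {set H}) (T_ : 'I_p.+1 -> {set H}) : Prop :=
  [/\ 2 <= p, (p, q) <> (2, 1), biclique U
    & exists w : 'I_p.+1 -> H,
        [/\ injective w, W = [set w i | i in 'I_p.+1]
          & forall i, biclique (w i |: (U :\: T_ i)) /\
              (forall v, v \in T_ i ->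
                 ~~ biclique (w i |: (v |: (U :\: T_ i))))]].

(* H is a (p+1,q,s)-biocular. *)
Definition biocular : Prop :=
  if (p == 1) && (q == 1) then
    s = 0 /\
    (sgraph_iso H (complement (path_graph 3)) \/
     sgraph_iso H (complete_graph 3))
  else
    exists (U W : {set H}) (T_ : 'I_p.+1 -> {set H}),
      [/\ U :|: W = [set: H], [disjoint U & W],
          #|U| = p.+1 * (q - s) + s,
          [/\ forall i, T_ i \subset U, forall i, #|T_ i| = q - s
            & pairwise_disjoint T_]
        & beta1 U W T_ \/ beta2 U W T_].

End Bioculars.

(* Main.v *)
(* All eight conditions say that the maximal bicliques contain no critical
   system: p+1 members M_0, ..., M_p such that, for every i, the intersection of
   the others has at least q elements and is not contained in M_i.
   For (ii)-(vi) this holds for arbitrary set families: a nonempty subfamily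
   that is minimal with given core and has more than p members yields a critical
   system, and a critical system contains a copy of J_(p+1,q,s) with
   s = min(|M_0 & ... & M_p|, q-1).
   For the graph conditions, a vertex set is a biclique if and only if
   adj x y + adj y z + adj x z = 0 mod 2 for all its vertices x, y, z, and this
   sum is a cocycle. So a vertex v outside a maximal biclique M that contains c
   is excluded by a triple c, w, v with w in M. *)
Require Import Defs.
From mathcomp Require Import all_boot all_order all_algebra.

Set Implicit Arguments.
Unset Strict Implicit.
Unset Printing Implicit Defensive.

(** * Critical systems in set families *)

(** Two of the conditions are not reached directly from a critical system. Condition (i) fixes [q],
    whereas a critical system is only guaranteed to violate the Helly property at some q' >= q. The
    violation is brought down to [q] by deleting all but q-1 points of the common intersection. The
    difficulty is that the traces of the M_i must remain maximal bicliques: for each excluded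
    vertex, an odd triple excluding it has to survive the deletion. In a beta_2 biocular one vertex
    w_i excludes every vertex of T_i, whereas a failure of (vii) offers a w depending on v. One w_i
    is therefore fixed and only the vertices of T_i that it excludes are kept, at the price of a
    larger s. This is possible because, in a biclique, exclusion by w_i does not depend on the third
    vertex of the triple. *)

Section SetCardinals.
Variable T : finType.

Lemma subset_of_card (A : {set T}) k :
  k <= #|A| -> exists2 B : {set T}, B \subset A & #|B| = k.
Proof.
rewrite -bin_gt0 -cards_draws => /card_gt0P[B].
by rewrite inE => /andP[sBA /eqP cB]; exists B.
Qed.

Lemma card_sunflower k r (S : {set T}) (T_ : 'I_k -> {set T}) :
  pairwise_disjoint T_ -> (forall i, [disjoint S & T_ i]) ->
  (forall i, #|T_ i| = r) -> #|S :|: \bigcup_i T_ i| = k * r + #|S|.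
Proof.
move=> dT dST cT; rewrite cardsU disjoint_setI0 ?cards0 ?subn0; last first.
  exact: bigcup_disjoint.
rewrite addnC; congr (_ + _); rewrite -sum1_card.
rewrite partition_disjoint_bigcup // (eq_bigr (fun=> r)) => [|i _].
  by rewrite sum_nat_const card_ord.
by rewrite sum1_card.
Qed.

Lemma card_diff_bigcup p r (U : {set T}) (T_ : 'I_p.+1 -> {set T}) i :
  (forall j, #|T_ j| = r) ->
  #|U| - p * r <= #|U :\: \bigcup_(j | j != i) T_ j|.
Proof.
move=> cT; rewrite cardsD leq_sub2l //; apply: leq_trans (_ : _ <= #|_|) _.
  exact: subset_leq_card (subsetIr _ _).
have -> : p * r = \sum_(j < p.+1 | j != i) #|T_ j|.
  rewrite (eq_bigr (fun=> r)) // sum_nat_const.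
  by rewrite cardC1 card_ord.
elim/big_rec2: _ => [|j n A _ leA]; first by rewrite cards0.
by rewrite cardsU (leq_trans (leq_subr _ _)) // leq_add2l.
Qed.

End SetCardinals.

Section CriticalSystems.
Variable T : finType.
Implicit Types (F : {set {set T}}) (p q : nat).

Lemma mem_core F x : reflect (forall S, S \in F -> x \in S) (x \in core F).
Proof. exact: bigcapP. Qed.

Lemma core_subset F F' : F' \subset F -> core F \subset core F'.
Proof.
move=> /subsetP sF; apply/subsetP => x /mem_core xF.
by apply/mem_core => S /sF; apply: xF.
Qed.

Definition others p (M : 'I_p.+1 -> {set T}) i := \bigcap_(j | j != i) M j.

Definition critical p q F (M : 'I_p.+1 -> {set T}) : Prop :=
  forall i, [/\ M i \in F, q <= #|others M i| & ~~ (others M i \subset M i)].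

Definition has_critical p q F := exists M, @critical p q F M.

Lemma mem_others p (M : 'I_p.+1 -> {set T}) i x :
  reflect (forall j, j != i -> x \in M j) (x \in others M i).
Proof. exact: bigcapP. Qed.

Lemma others_sub p (M : 'I_p.+1 -> {set T}) i j :
  j != i -> others M i \subset M j.
Proof. by move=> ji; apply: bigcap_inf. Qed.

Lemma critical_inj p q F M : @critical p q F M -> injective M.
Proof.
move=> critM i j eqM; apply/eqP/negPn/negP => neq_ij.
have [_ _ /negP[]] := critM i.
by rewrite eqM others_sub // eq_sym.
Qed.

Section Private.
Variables (p : nat) (F : {set {set T}}).
Hypotheses (p_gt0 : 0 < p) (F_neq0 : F != set0).
Hypothesis small_core : forall F' : {set {set T}},
  F' \subset F -> F' != set0 -> #|F'| <= p -> core F' != core F.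

(** In a subfamily minimal with the core of [F], dropping a member enlarges the core, so each member
    misses a point common to all the others. [small_core] forces more than [p] members, and any p+1
    of them keep these private points. *)
Lemma private_points : exists M : 'I_p.+1 -> {set T},
  forall i, M i \in F /\ ~~ (others M i \subset M i).
Proof.
pose P (F' : {set {set T}}) := [&& F' \subset F, F' != set0 & core F' == core F].
have PF : P F by rewrite /P subxx F_neq0 eqxx.
have [F1 /minsetP[/and3P[sF1F F1_neq0 /eqP coreF1] minF1] _] := minset_exists PF.
have ltpF1 : p < #|F1|.
  by rewrite ltnNge; apply/negP=> /small_core-/(_ sF1F F1_neq0)/eqP[].
pose M (i : 'I_p.+1) : {set T} := enum_val (widen_ord ltpF1 i).
have M_inj : injective M.
  by move=> i j /enum_val_inj/(congr1 val)/= ij; apply: val_inj.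
have MF i : M i \in F1 by apply: enum_valP.
exists M => i; split; first exact: (subsetP sF1F).
have F1i_neq0 : F1 :\ M i != set0.
  rewrite -card_gt0 (leq_trans p_gt0) // -ltnS.
  by rewrite (leq_trans ltpF1) // (cardsD1 (M i)) MF.
have : core (F1 :\ M i) != core F1.
  apply/eqP => eqc; have := minF1 (F1 :\ M i).
  rewrite /P F1i_neq0 eqc coreF1 eqxx (subset_trans (subsetDl _ _) sF1F).
  move=> /(_ isT (subsetDl _ _)) eqF; have := MF i.
  by rewrite -eqF !inE eqxx.
rewrite eqEsubset (core_subset (subsetDl _ _)) andbT => /subsetPn[x].
move=> /mem_core xF1 xNF1; apply/subsetPn; exists x.
  apply/mem_others => j ji; apply: xF1.
  by rewrite !inE MF andbT; apply: contra ji => /eqP/M_inj->.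
apply: contra xNF1 => xMi; apply/mem_core => S SF1.
by have [->|neS] := eqVneq S (M i); [|apply: xF1; rewrite !inE neS].
Qed.

End Private.

(** Private points give the non-inclusions; the bound on [others M i] is the intersection hypothesis
    applied to the at most [p] members other than [M i]. *)
Lemma strong_of_not_critical p q F :
  0 < p -> ~ has_critical p q F -> strong_pq_Helly p q F.
Proof.
move=> p_gt0 noM F1 sF1 F1_neq0 intF1.
have [/existsP[F2 /and4P[? ? ? /eqP ?]]|/existsPn noF2] := boolP [exists F2 : {set {set T}},
  [&& F2 \subset F1, F2 != set0, #|F2| <= p & core F2 == core F1]].
  by exists F2.
have [F2 sF2 F2_neq0 cF2|M MP] := private_points p_gt0 F1_neq0.
  by have := noF2 F2; rewrite sF2 F2_neq0 cF2.
case: noM; exists M => i; have [MF nsub] := MP i; split=> //.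
  exact: (subsetP sF1).
pose F2 := [set M j | j in [set~ i]].
have sF2 : F2 \subset F1 by apply/subsetP=> _ /imsetP[j _ ->]; case: (MP j).
have cF2 : #|F2| <= p.
  by rewrite (leq_trans (leq_imset_card _ _)) // cardsC1 card_ord.
have F2_neq0 : F2 != set0.
  rewrite -card_gt0; apply/card_gt0P; have j : 'I_p := Ordinal p_gt0.
  by exists (M (lift i j)); apply: imset_f; rewrite !inE eq_sym neq_lift.
apply: leq_trans (intF1 F2 sF2 F2_neq0 cF2) (subset_leq_card _).
apply/subsetP => x /mem_core xF2; apply/mem_others => j ji.
by apply/xF2/imset_f; rewrite !inE.
Qed.

Lemma strong_sub p q F F' :
  F' \subset F -> strong_pq_Helly p q F -> strong_pq_Helly p q F'.
Proof. by move=> sF strF F1 sF1; apply: strF; apply: subset_trans sF. Qed.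

(** The subfamily supplied by strongness has at most [p] members, so the bound q' applies to its
    core. *)
Lemma strong_Helly p q q' F :
  q <= q' -> strong_pq_Helly p q F -> pq_Helly p q' F.
Proof.
move=> leq strF F1 sF1 F1_neq0 intF1.
have [|F2 [sF2 F2_neq0 cF2 <-]] := strF F1 sF1 F1_neq0; last exact: intF1.
by move=> F2 sF2 F2_neq0 cF2; apply: leq_trans (intF1 F2 sF2 F2_neq0 cF2).
Qed.

Section OfCritical.
Variables (p q : nat) (F : {set {set T}}) (M : 'I_p.+1 -> {set T}).
Hypotheses (p_gt0 : 0 < p) (critM : critical q F M).

Let M_inj := critical_inj critM.
Let FM := [set M i | i in 'I_p.+1].

Lemma critical_family_sub : FM \subset F.
Proof. by apply/subsetP=> _ /imsetP[i _ ->]; have [] := critM i. Qed.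

Lemma critical_family_neq0 : FM != set0.
Proof. by apply/set0Pn; exists (M ord0); apply: imset_f. Qed.

Lemma card_critical_family : #|FM| = p.+1.
Proof. by rewrite card_imset // card_ord. Qed.

Lemma core_critical_family i : core FM = M i :&: others M i.
Proof.
apply/setP => x; rewrite inE; apply/mem_core/andP => [xM|[xi /mem_others xo]].
  split; first exact/xM/imset_f.
  by apply/mem_others => j _; apply/xM/imset_f.
move=> _ /imsetP[j _ ->]; have [->//|] := eqVneq j i; exact: xo.
Qed.

Lemma critical_small F' :
  F' \subset FM -> #|F'| <= p -> exists i, others M i \subset core F'.
Proof.
move=> sF' cF'; have /subsetPn[_ /imsetP[i _ ->] MiF'] : ~~ (FM \subset F').
  by apply: contraL cF' => /subset_leq_card; rewrite card_critical_family ltnNge.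
exists i; apply/subsetP => x /mem_others xo; apply/mem_core => S SF'.
have /imsetP[j _ eqS] := subsetP sF' S SF'; rewrite eqS; apply: xo.
by apply: contraNneq MiF' => <-; rewrite -eqS.
Qed.

Lemma critical_intersecting q' :
  (forall i, q' <= #|others M i|) -> pq_intersecting p q' FM.
Proof.
move=> leq F' sF' _ /critical_small-/(_ sF')[i].
by move=> /subset_leq_card; apply: leq_trans.
Qed.

Lemma critical_not_strong : ~ strong_pq_Helly p q FM.
Proof.
move=> strF; have [||| F' [sF' _ cF' eqF']] := strF FM => //.
- exact: critical_family_neq0.
- by apply: critical_intersecting => i; have [] := critM i.
have [i] := critical_small sF' cF'; rewrite eqF' (core_critical_family i).
by rewrite subsetI => /andP[sM _]; have [_ _ /negP] := critM i.
Qed.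

Lemma critical_not_Helly : exists2 q', q <= q' & ~ pq_Helly p q' F.
Proof.
(* The witness q' is the smallest [#|others M i|]: the members are (p,q')-intersecting, but their
   core is a proper subset of that smallest intersection. *)
have [i0 _ minM] := arg_minnP (P := predT) (fun i => #|others M i|) (erefl : predT (@ord0 p)).
exists #|others M i0| => [|HF]; first by have [] := critM i0.
have := HF FM critical_family_sub critical_family_neq0.
rewrite leqNgt (core_critical_family i0) => /(_ _)/negP[].
  by apply: critical_intersecting => i; apply: minM.
apply: proper_card; rewrite properE subsetIr subsetI negb_and subxx orbF.
by have [] := critM i0.
Qed.

Lemma critical_flower : 0 < q ->
  exists s (S : {set T}) (T_ : 'I_p.+1 -> {set T}),
    [/\ s < q, #|S| = s, forall i, #|T_ i| = q - s,
        forall i, S \subset M i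
      & forall i, T_ i \subset others M i :\: M i].
Proof.
(* Petals of size q-s must fit into [others M i :\: M i], that is, [others M i :\: K]. If [#|K| < q]
   this set has at least q - #|K| points; otherwise only one point is guaranteed, whence s = q-1. *)
move=> q_gt0; pose K := core FM; pose s := minn #|K| q.-1.
have ltsq : s < q by rewrite -[X in _ < X](prednK q_gt0) ltnS geq_minr.
have [S sSK cS] := subset_of_card (geq_minl #|K| q.-1).
have oK i : others M i :\: M i = others M i :\: K.
  by rewrite /K (core_critical_family i) setDIr setDv setU0.
have leqT i : q - s <= #|others M i :\: M i|.
  have [_ leq nsub] := critM i.
  have [ltKq|leqK] := ltnP #|K| q; last first.
    rewrite /s (minn_idPr _); last exact: leq_trans (leq_pred _) leqK.
    by rewrite -[X in X - _](prednK q_gt0) subSnn card_gt0 setD_eq0.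
  have leKq : #|K| <= q.-1 by rewrite -ltnS (prednK q_gt0).
  rewrite /s (minn_idPl leKq) oK cardsD leq_sub //.
  exact: subset_leq_card (subsetIr _ _).
have /fin_all_exists2[T_ sT cT] i := subset_of_card (leqT i).
exists s, S, T_; split=> // i; apply: subset_trans sSK _.
by rewrite /K (core_critical_family i) subsetIl.
Qed.

End OfCritical.

End CriticalSystems.

(** * Disjoint petals inside a critical system *)

Section Flowers.
Variable T : finType.
Implicit Types (F : {set {set T}}) (p q r s : nat).

Lemma ord_neq p (i : 'I_p.+1) : 0 < p -> exists j, j != i.
Proof. by case: p i => // p i _; exists (lift i ord0); rewrite eq_sym neq_lift. Qed.

Lemma ord_neq2 p (i j : 'I_p.+1) : 1 < p -> exists k, (k != i) && (k != j).
Proof.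
move=> p_gt1; have [|k] := card_gt0P (_ : 0 < #|~: [set i; j]|).
  rewrite cardsCs setCK card_ord cards2 subn_gt0.
  by case: (i != j); rewrite ltnS // (leq_trans _ p_gt1).
by rewrite !inE negb_or => ?; exists k.
Qed.

(** The petal T_i avoids M_i while every other petal lies in M_i; hence the petals are disjoint and
    M_i meets U exactly in U - T_i. *)
Lemma critical_flower_disjoint p q F (M : 'I_p.+1 -> {set T}) :
    0 < p -> 0 < q -> critical q F M ->
  exists s (U : {set T}) (T_ : 'I_p.+1 -> {set T}),
    [/\ s < q, #|U| = p.+1 * (q - s) + s,
        [/\ forall i, T_ i \subset U, forall i, #|T_ i| = q - s
          & pairwise_disjoint T_],
        forall i, U :\: T_ i \subset M i
      & forall i, [disjoint T_ i & M i]].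
Proof.
move=> p_gt0 q_gt0 /critical_flower[]// s [S [T_ [ltsq cS cT SM TM]]].
have TMj i j : j != i -> T_ i \subset M j.
  move=> /(others_sub M); apply: subset_trans.
  by apply: subset_trans (TM i) _; apply: subsetDl.
have dTM i : [disjoint T_ i & M i].
  rewrite disjoint_subset (subset_trans (TM i)) //.
  by apply/subsetP=> x; rewrite !inE => /andP[].
have dT : pairwise_disjoint T_.
  by move=> i j neq_ij; rewrite disjoint_sym (disjointWr (TMj _ _ _) (dTM j)) // eq_sym.
exists s, (S :|: \bigcup_i T_ i), T_; split=> //.
- rewrite (card_sunflower (r := q - s)) ?cS // => i.
  by rewrite disjoint_sym (disjointWr (SM i)).
- by split=> // i; rewrite subsetU // orbC (bigcup_sup i).
- move=> i; apply/subsetP => x; rewrite !inE => /andP[xTi /orP[|/bigcupP[j _]]].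
    exact: (subsetP (SM i)).
  have [->|ji] := eqVneq j i; first by rewrite (negPf xTi).
  by apply/subsetP/TMj; rewrite eq_sym.
Qed.

(** This is what the size of U is made for: taking [p] petals of size q-s from (p+1)(q-s)+s points
    leaves q. *)
Lemma others_of_flower p q s (U : {set T}) (T_ : 'I_p.+1 -> {set T}) i :
    s <= q -> #|U| = p.+1 * (q - s) + s -> (forall j, #|T_ j| = q - s) ->
  q <= #|U :\: \bigcup_(j | j != i) T_ j|.
Proof.
move=> lesq cU cT; apply: leq_trans (card_diff_bigcup U i cT).
by rewrite cU mulSn -addnA addnCA addKn subnK.
Qed.

Lemma sub_others_of_flower p (U : {set T}) (T_ : 'I_p.+1 -> {set T}) i j :
  j != i -> U :\: \bigcup_(j | j != i) T_ j \subset U :\: T_ j.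
Proof. by move=> ji; apply/setDS/(bigcup_sup j). Qed.

End Flowers.

(** * Critical systems and incidence submatrices *)

Section Matrices.
Variables (T : finType) (F : {set {set T}}) (m n : nat) (B : 'M[nat]_(m, n)).
Hypothesis incB : incidence_matrix [set: T] F B.
Variables p q : nat.
Hypotheses (p_gt0 : 0 < p) (q_gt0 : 0 < q).

(** [submatrix] wants increasing index maps; enumerating a set of ordinals provides them. *)
Lemma enum_val_ord_homo k (A : {set 'I_k}) :
  {homo (enum_val : 'I_#|A| -> 'I_k) : i j / i < j}.
Proof.
move=> i j lt_ij; have k0 : 'I_k by apply: (enum_val i).
rewrite !(enum_val_nth k0).
have srt : sorted (relpre val ltn) (enum A).
  have -> : enum A = [seq x <- enum 'I_k | x \in A] by rewrite enumT.
  apply: sorted_filter.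
    by move=> y x z /= xy yz; apply: ltn_trans yz.
  by rewrite -sorted_map val_enum_ord iota_ltn_sorted.
apply: (sorted_ltn_nth _ _ srt); rewrite ?inE -?cardE ?ltn_ord //.
by move=> y x z /= xy yz; apply: ltn_trans yz.
Qed.

(** The traces of the M_i on U are the sets U - T_i, so the rows of the M_i and the columns of U cut
    out the required matrix. *)
Lemma submatrix_of_critical : has_critical p q F ->
  exists2 s, s < q & exists (T' : finType) (J : hypergraph T') k l (N : 'M[nat]_(k, l)),
    [/\ is_J p.+1 q s J, incidence_matrix (hvert J) (hedges J) N & submatrix N B].
Proof.
case=> M critM; have [rw [cl [rw_inj cl_inj im_rw im_cl BE]]] := incB.
have := critical_flower_disjoint p_gt0 q_gt0 critM.
case=> s [U [T_ [ltsq cU [sTU cT dT] sUM dTM]]]; exists s => //.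
have MU i : M i :&: U = U :\: T_ i.
  apply/setP => x; rewrite !inE; have [xU|] := boolP (x \in U); last by rewrite !andbF.
  rewrite !andbT; apply/idP/idP => [xM|xT]; first by rewrite (disjointFl (dTM i)).
  by apply: (subsetP (sUM i)); rewrite !inE xT.
have T_neq0 i : exists x, x \in T_ i.
  by apply/card_gt0P; rewrite cT subn_gt0.
pose E := [set U :\: T_ i | i in 'I_p.+1].
have E_neq0 : set0 \notin E.
  apply/imsetP => -[i _ /esym/eqP]; rewrite setD_eq0 => sUT.
  have [j ji] := ord_neq i p_gt0; have [x xTj] := T_neq0 j.
  have := subsetP sUT x (subsetP (sTU j) x xTj).
  by rewrite (disjointFr (dT j i ji)).
have E_cover : cover E = U.
  apply/setP => x; apply/bigcupP/idP => [[_ /imsetP[i _ ->]]|xU].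
    by rewrite inE => /andP[].
  have [xT|xT] := boolP (x \in T_ ord0); last first.
    by exists (U :\: T_ ord0); [apply: imset_f | rewrite inE xT].
  have [j j0] := ord_neq (@ord0 p) p_gt0.
  exists (U :\: T_ j); first exact: imset_f.
  by rewrite inE xU (disjointFl (dT _ _ j0)).
exists T, (Hypergraph E_neq0 E_cover).
pose f : 'I_#|[set a | rw a \in [set M i | i in 'I_p.+1]]| -> 'I_m := enum_val.
pose g : 'I_#|[set b | cl b \in U]| -> 'I_n := enum_val.
have fP a : exists i, rw (f a) = M i.
  by have := enum_valP a; rewrite inE => /imsetP[i _]; exists i.
exists _, _, (mxsub f g B); split; last by exists f, g; split; try apply: enum_val_ord_homo.
  by split=> //=; exists T_.
exists (fun a => rw (f a) :&: U), (cl \o g); split=> /=.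
- move=> a b; have [i Ma] := fP a; have [j Mb] := fP b.
  have [eq_ij _|neq_ij] := eqVneq i j.
    by apply/enum_val_inj/rw_inj; rewrite -/(f a) -/(f b) Ma Mb eq_ij.
  have [x xTi] := T_neq0 i; move/setP/(_ x); rewrite Ma Mb !MU !inE xTi.
  by rewrite (disjointFr (dT _ _ neq_ij)) // (subsetP (sTU i)).
- exact: inj_comp cl_inj (@enum_val_inj _ _).
- apply/setP => S; apply/imsetP/imsetP => [[a _ ->]|[i _ ->]].
    by have [i ->] := fP a; exists i => //; rewrite MU.
  have : M i \in F by have [] := critM i.
  rewrite -im_rw => /imsetP[a _ Ma].
  have Aa : a \in [set a | rw a \in [set M i | i in 'I_p.+1]].
    by rewrite inE -Ma imset_f.
  by exists (enum_rank_in Aa a) => //; rewrite /f enum_rankK_in // -Ma MU.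
- apply/setP => x; apply/imsetP/idP => [[b _ ->]|xU].
    by have := enum_valP b; rewrite inE.
  have : x \in [set: T] by [].
  rewrite -im_cl => /imsetP[b _ xb].
  have Ab : b \in [set b | cl b \in U] by rewrite inE -xb.
  by exists (enum_rank_in Ab b) => //=; rewrite /g enum_rankK_in.
- move=> a b; rewrite mxE BE !inE.
  by have := enum_valP b; rewrite inE => ->; rewrite andbT.
Qed.

Lemma critical_of_submatrix s (T' : finType) (J : hypergraph T') k l
    (N : 'M[nat]_(k, l)) :
    s < q -> is_J p.+1 q s J -> incidence_matrix (hvert J) (hedges J) N ->
  submatrix N B -> has_critical p q F.
Proof.
move=> ltsq [cV [T_ [sTV cT dT EJ]]] [rN [cN [rN_inj cN_inj im_rN im_cN NE]]].
case=> f [g [f_homo g_homo eqN]].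
have [rw [cl [rw_inj cl_inj im_rw im_cl BE]]] := incB.
have g_inj : injective g.
  move=> a b; have [/g_homo|/g_homo|/val_inj//] := ltngtP a b.
    by move=> + eqg; rewrite eqg ltnn.
  by move=> + eqg; rewrite eqg ltnn.
have /fin_all_exists[h hP] (i : 'I_p.+1) : exists a, rN a = hvert J :\: T_ i.
  have : hvert J :\: T_ i \in hedges J by rewrite EJ; apply: imset_f.
  by rewrite -im_rN => /imsetP[a _]; exists a.
pose M i := rw (f (h i)).
(* On the selected columns the set M_i looks like V - T_i, so both requirements of criticality can
   be read off inside V. *)
have memM i b : (cl (g b) \in M i) = (cN b \in hvert J :\: T_ i).
  have := NE (h i) b; rewrite eqN mxE BE hP /M.
  by case: (_ \in _); case: (_ \in _).
exists M => i; split; first by rewrite -im_rw; apply: imset_f.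
  apply: leq_trans (others_of_flower i (ltnW ltsq) cV cT) _.
  set Z := _ :\: _; pose D := [set b | cN b \in Z].
  have -> : #|Z| = #|D|.
    rewrite -(card_imset _ cN_inj); apply: eq_card => x.
    apply/idP/imsetP => [xZ|[b + ->]]; last by rewrite inE.
    have : x \in hvert J by move: xZ; rewrite inE => /andP[].
    by rewrite -im_cN => /imsetP[b _ xb]; exists b => //; rewrite inE -xb.
  rewrite -(card_imset _ (inj_comp cl_inj g_inj)); apply: subset_leq_card.
  apply/subsetP => _ /imsetP[b + ->]; rewrite inE => bZ.
  apply/mem_others => j ji /=; rewrite memM.
  exact: subsetP (sub_others_of_flower _ _ ji) _ bZ.
have /card_gt0P[x xT] : 0 < #|T_ i| by rewrite cT subn_gt0.
have xV := subsetP (sTV i) x xT.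
have := xV; rewrite -im_cN => /imsetP[b _ xb].
apply/subsetPn; exists (cl (g b)); last by rewrite memM -xb inE xT.
apply/mem_others => j ji; rewrite memM -xb inE xV andbT.
by rewrite (disjointFl (dT _ _ ji)).
Qed.

End Matrices.

(** * Critical systems and the hypergraph of q-subsets *)

Section PhiHelly.
Variables (T : finType) (H : hypergraph T) (p q : nat).
Hypothesis p_gt0 : 0 < p.

Let phi (E : {set T}) := [set S : {set T} | (S \subset E) && (#|S| == q)].

(** A private point of an edge of the subhypergraph is a q-set Q that lies in all the other M_j but
    not in M_i; Q itself shows both that [others M i] has q points and that it is not inside M_i. *)
Lemma Phi_Helly_of_not_critical :
  ~ has_critical p q (hedges H) -> hereditary_p_Helly p (Phi q H).
Proof.
move=> noM X sX F sF F_neq0 smallF; apply/negP => /eqP coreF.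
have [F' sF' F'_neq0 cF'|E EP] := private_points p_gt0 F_neq0.
  by rewrite coreF smallF.
case: noM.
have /fin_all_exists[M MP] i : exists M, M \in hedges H /\ E i = phi M :&: X.
  have [/(subsetP sF) + _] := EP i; rewrite !inE => /andP[_ /imsetP[E' /imsetP[M + ->] ->]].
  by rewrite inE => /andP[MH _]; exists M.
exists M => i; have [_ /subsetPn[Q /mem_others QE QNE]] := EP i.
have [j ji] := ord_neq i p_gt0.
have := QE j ji; case: (MP j) => _ ->; rewrite !inE => /andP[/andP[_ /eqP cQ] QX].
have sQ : Q \subset others M i.
  apply/bigcapsP => k ki; have := QE k ki; case: (MP k) => _ ->.
  by rewrite !inE => /andP[/andP[]].
split; first by case: (MP i).
  by rewrite -cQ subset_leq_card.
apply: contra QNE => soM; case: (MP i) => _ ->.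
by rewrite !inE (subset_trans sQ soM) cQ eqxx QX.
Qed.

(** Choose a q-set Q_i inside [others M i] but not inside M_i. On the vertices Q_0, ..., Q_p the
    trace of the i-th edge omits exactly Q_i, so any [p] traces meet and all p+1 do not. *)
Lemma not_Phi_Helly_of_critical : 0 < q ->
  has_critical p q (hedges H) -> ~ hereditary_p_Helly p (Phi q H).
Proof.
move=> q_gt0 [M critM] HH.
have /fin_all_exists[Q QP] i : exists Q : {set T},
    [/\ Q \subset others M i, ~~ (Q \subset M i) & #|Q| = q].
  have [_ leq /subsetPn[x xo xM]] := critM i.
  have [|B sB cB] := @subset_of_card _ (others M i :\ x) q.-1.
    by rewrite -ltnS (prednK q_gt0) (leq_trans leq) // (cardsD1 x) xo.
  have xB : x \notin B by apply: contraTN xo => /(subsetP sB); rewrite !inE eqxx.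
  exists (x |: B); split.
  - by rewrite subUset sub1set xo (subset_trans sB (subsetDl _ _)).
  - by apply: contra xM => /subsetP-> //; rewrite !inE eqxx.
  - by rewrite cardsU1 xB cB add1n prednK.
have QM i j : (Q i \subset M j) = (j != i).
  have [-> | ji] := eqVneq j i; first by apply/negbTE; case: (QP i).
  by case: (QP i) => sQ _ _; apply: subset_trans sQ (others_sub M ji).
have leqM i : q <= #|M i|.
  have [j ji] := ord_neq i p_gt0; case: (QP j) => _ _ <-.
  by rewrite subset_leq_card // QM eq_sym.
pose X := [set Q i | i in 'I_p.+1].
have sX : X \subset hvert (Phi q H).
  apply/subsetP => _ /imsetP[i _ ->]; rewrite inE.
  have [j ji] := ord_neq i p_gt0; have [MH _ _] := critM j.
  by case: (QP i) => _ _ ->; rewrite eqxx; apply/existsP; exists (M j); rewrite MH QM.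
pose E i := phi (M i) :&: X.
have QE i j : (Q i \in E j) = (j != i).
  have QX : Q i \in X by apply: imset_f.
  by rewrite !inE QM QX; case: (QP i) => _ _ ->; rewrite eqxx !andbT.
have E_inj : injective E.
  move=> i j eqE; apply/eqP; have := QE j i; rewrite eqE QE eqxx.
  by move/esym/negbFE.
pose F := [set E i | i in 'I_p.+1].
have sF : F \subset hedges (subhypergraph sX).
  apply/subsetP => _ /imsetP[i _ ->]; have [MH _ _] := critM i.
  rewrite !inE; apply/andP; split.
    have [j ji] := ord_neq i p_gt0; apply/set0Pn; exists (Q j).
    by rewrite QE eq_sym.
  by apply/imsetP; exists (phi (M i)) => //; apply: imset_f; rewrite inE MH leqM.
have F_neq0 : F != set0 by apply/set0Pn; exists (E ord0); apply: imset_f.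
have /set0Pn[S /mem_core SF] : core F != set0.
  apply: (HH X sX F sF F_neq0) => F' sF' _ cF'.
  have /subsetPn[_ /imsetP[i _ ->] EiF'] : ~~ (F \subset F').
    apply: contraL cF' => /subset_leq_card.
    by rewrite card_imset // card_ord ltnNge.
  apply/set0Pn; exists (Q i); apply/mem_core => S SF'.
  have /imsetP[j _ eqS] := subsetP sF' S SF'; rewrite eqS QE.
  by apply: contraNneq EiF' => <-; rewrite -eqS.
have /imsetP[i _ eqS] : S \in X.
  by have := SF _ (imset_f E (isT : ord0 \in 'I_p.+1)); rewrite inE => /andP[].
by have := SF _ (imset_f E (isT : i \in 'I_p.+1)); rewrite eqS QE eqxx.
Qed.

End PhiHelly.

(** * Bicliques *)

Section Bicliques.
Variable G : sgraph.
Implicit Types (x y z c v w : G) (S A B : {set G}).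

(** The odd triples form the two-graph of [G] in the sense of Seidel; triples with a repeated vertex
    are even. *)
Definition parity x y z := adj x y (+) adj y z (+) adj x z.

Lemma parityxx x y : parity x y y = false.
Proof. by rewrite /parity adj_irr addbF addbb. Qed.

Lemma parity_swapr x y z : parity x z y = parity x y z.
Proof. by rewrite /parity (adj_sym z); do 3!case: (adj _ _). Qed.

Lemma parity_swapl x y z : parity y x z = parity x y z.
Proof. by rewrite /parity (adj_sym y x) addbAC. Qed.

Lemma parity_cocycle c x y z :
  parity x y z = parity c x y (+) parity c y z (+) parity c x z.
Proof.
rewrite /parity.
by case: (adj c x); case: (adj c y); case: (adj c z); case: (adj x y);
   case: (adj y z); case: (adj x z).
Qed.

(** Adjacency in a complete bipartite graph is the mod 2 coboundary of one side, so it sums to zero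
    over triples. Conversely, the nonneighbours of any fixed vertex form one side. *)
Lemma bicliqueP S :
  reflect (forall x y z, x \in S -> y \in S -> z \in S -> ~~ parity x y z)
          (biclique S).
Proof.
apply: (iffP existsP) => [[A /and3P[stA stB AB]] x y z xS yS zS|parS].
  have adjE (u v : induced S) : adj u v = (u \in A) (+) (v \in A).
    have [uA|uA] := boolP (u \in A); have [vA|vA] := boolP (v \in A).
    - exact/negbTE/(forall_inP (forall_inP stA u uA)).
    - by apply: (forall_inP (forall_inP AB u uA)); rewrite inE.
    - by rewrite adj_sym; apply: (forall_inP (forall_inP AB v vA)); rewrite inE.
    - by apply/negbTE/(forall_inP (forall_inP stB u _)); rewrite inE.
  pose u : induced S := Sub x xS; pose v : induced S := Sub y yS.
  pose t : induced S := Sub z zS.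
  rewrite /parity -[adj x y]/(adj u v) -[adj y z]/(adj v t) -[adj x z]/(adj u t).
  by rewrite !adjE; case: (u \in A); case: (v \in A); case: (t \in A).
have [c cS|S0] := pickP (mem S); last first.
  exists setT; apply/and3P; split; apply/forall_inP => -[u uS] _.
  - by have := S0 u; rewrite /= uS.
  - by have := S0 u; rewrite /= uS.
  - by have := S0 u; rewrite /= uS.
exists [set u : induced S | ~~ adj c (val u)]; apply/and3P; split;
  apply/forall_inP => -[u uS] /=; rewrite !inE /= => cu;
  apply/forall_inP => -[v vS] /=; rewrite !inE /= => cv;
  rewrite /induced_adj /=; have := parS c u v cS uS vS; rewrite /parity.
- by rewrite (negPf cu) (negPf cv) addbF.
- by rewrite (negPn cu) (negPn cv); case: (adj u v).
- by rewrite (negPf cu) (negPn cv); case: (adj u v).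
Qed.

Lemma biclique_sub A B : A \subset B -> biclique B -> biclique A.
Proof.
by move=> /subsetP sAB /bicliqueP bB; apply/bicliqueP => x y z *; apply: bB; apply: sAB.
Qed.

Lemma parity_biclique S x y z :
  biclique S -> x \in S -> y \in S -> z \in S -> parity x y z = false.
Proof. by move=> /bicliqueP bS xS yS zS; apply/negbTE/bS. Qed.

Lemma nonbicliqueP S :
  reflect (exists x y z, [/\ x \in S, y \in S, z \in S & parity x y z])
          (~~ biclique S).
Proof.
apply: (iffP idP) => [nbS|[x [y [z [xS yS zS]]]]]; last first.
  by apply: contraL => bS; rewrite (parity_biclique bS).
have [|no] := boolP [exists x in S, exists y in S, exists z in S, parity x y z].
  case/exists_inP=> x xS /exists_inP[y yS /exists_inP[z zS par]].
  by exists x, y, z.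
case/negP: nbS; apply/bicliqueP => x y z xS yS zS; apply: contra no => par.
apply/exists_inP; exists x => //; apply/exists_inP; exists y => //.
by apply/exists_inP; exists z.
Qed.

(* By the cocycle identity, the triples through one fixed vertex decide. *)
Lemma nonbiclique_ext c S v : c \in S -> biclique S -> ~~ biclique (v |: S) ->
  exists2 w, w \in S & parity c w v.
Proof.
move=> cS bS nb; have [/exists_inP//|/exists_inPn no] :=
  boolP [exists w in S, parity c w v].
case/negP: nb; apply/bicliqueP.
have par0 x y : x \in v |: S -> y \in v |: S -> parity c x y = false.
  move=> /setU1P[->|xS] /setU1P[->|yS]; first exact: parityxx.
  - by rewrite parity_swapr; apply/negbTE/no.
  - exact/negbTE/no.
  - exact: parity_biclique bS _ _ _.
by move=> x y z xS yS zS; rewrite (parity_cocycle c) !par0.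
Qed.

Lemma parity_card x y z : parity x y z -> #|[set x; y; z]| = 3.
Proof.
move=> par; have xy : x != y.
  by apply: contraTneq par => ->; rewrite parity_swapr parity_swapl parityxx.
have yz : y != z by apply: contraTneq par => ->; rewrite parityxx.
have xz : x != z.
  by apply: contraTneq par => ->; rewrite parity_swapl parityxx.
by rewrite setUC cardsU1 cards2 !inE xy negb_or !(eq_sym z) xz yz.
Qed.

Lemma biclique_card2 S : #|S| <= 2 -> biclique S.
Proof.
apply: contraTT => /nonbicliqueP[x [y [z [xS yS zS /parity_card c3]]]].
by rewrite -ltnNge -c3 subset_leq_card // !subUset !sub1set xS yS.
Qed.

Lemma biclique_extend S : biclique S ->
  exists2 M, M \in max_bicliques G & S \subset M.
Proof. by case/maxset_exists=> M maxM sSM; exists M; rewrite ?inE. Qed.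

Lemma max_bicliqueP M : reflect
  (biclique M /\ forall B, biclique B -> M \subset B -> B = M)
  (M \in max_bicliques G).
Proof. by rewrite inE; apply: maxsetP. Qed.

Lemma max_biclique_ext M c v : M \in max_bicliques G -> c \in M -> v \notin M ->
  exists2 w, w \in M & parity c w v.
Proof.
case/max_bicliqueP=> bM maxM cM vM; apply: nonbiclique_ext => //.
by apply: contra vM => /maxM<-; rewrite ?subsetUr // setU11.
Qed.

End Bicliques.

Lemma biclique_imset (G H : sgraph) (h : H -> G) (S : {set H}) :
  (forall x y, adj (h x) (h y) = adj x y) -> biclique (h @: S) = biclique S.
Proof.
move=> hadj; have par x y z : parity (h x) (h y) (h z) = parity x y z.
  by rewrite /parity !hadj.
apply/bicliqueP/bicliqueP => bS => [x y z xS yS zS|].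
  by rewrite -par; apply: bS; apply: imset_f.
by move=> _ _ _ /imsetP[x xS ->] /imsetP[y yS ->] /imsetP[z zS ->]; rewrite par bS.
Qed.

Lemma biclique_val (G : sgraph) (X : {set G}) (S : {set induced X}) :
  biclique [set val x | x in S] = biclique S.
Proof. exact: (@biclique_imset G (induced X) val). Qed.

(** * Blocked flowers and strongness *)

Section Blocked.
Variables (G : sgraph) (p q : nat).
Hypotheses (p_gt0 : 0 < p) (q_gt0 : 0 < q).

(* The configurations that (vii) excludes. *)
Definition blocked_flower s (U : {set G}) (T_ : 'I_p.+1 -> {set G}) : Prop :=
  [/\ #|U| = p.+1 * (q - s) + s,
      [/\ forall i, T_ i \subset U, forall i, #|T_ i| = q - s
        & pairwise_disjoint T_],
      forall i, biclique (U :\: T_ i)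
    & forall i v, v \in T_ i -> exists w,
        biclique (w |: (U :\: T_ i)) && ~~ biclique (v |: (w |: (U :\: T_ i)))].

Lemma flower_setD (U : {set G}) (T_ : 'I_p.+1 -> {set G}) i j :
  (forall i, T_ i \subset U) -> pairwise_disjoint T_ -> j != i ->
  T_ j \subset U :\: T_ i.
Proof.
move=> sTU dT ji; apply/subsetP => x xT; rewrite inE (subsetP (sTU j)) // andbT.
by rewrite (disjointFr (dT _ _ ji)).
Qed.

Lemma not_strong_of_blocked s U T_ :
  s < q -> blocked_flower s U T_ -> ~ strong_biclique_Helly p q G.
Proof.
move=> ltsq [cU [sTU cT dT] bU blU] strG.
pose F := [set M in max_bicliques G | [exists i, U :\: T_ i \subset M]].
have missed (F' : {set {set G}}) : F' \subset F -> #|F'| <= p ->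
    exists i, forall M, M \in F' -> exists2 j, j != i & U :\: T_ j \subset M.
  move=> sF' cF'; pose idx (M : {set G}) := odflt ord0 [pick i | U :\: T_ i \subset M].
  have /subsetPn[i _ idxi] : ~~ ([set: 'I_p.+1] \subset idx @: F').
    apply: contraL cF' => /subset_leq_card; rewrite cardsT card_ord -ltnNge => le.
    exact: leq_trans le (leq_imset_card _ _).
  exists i => M MF'; exists (idx M); first by apply: contraNneq idxi => <-; apply: imset_f.
  have := subsetP sF' M MF'; rewrite inE /idx => /andP[_ /existsP[j sj]].
  by case: pickP => // /(_ j); rewrite sj.
have F_neq0 : F != set0.
  have [M MG sM] := biclique_extend (bU ord0).
  by apply/set0Pn; exists M; rewrite inE MG; apply/existsP; exists ord0.
have [||| F' [sF' _ cF' eqF']] := strG F => //.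
- by apply/subsetP=> M; rewrite inE => /andP[].
- move=> F' sF' _ cF'; have [i iP] := missed F' sF' cF'.
  apply: leq_trans (others_of_flower i (ltnW ltsq) cU cT) (subset_leq_card _).
  apply/subsetP => x xZ; apply/mem_core => M /iP[j ji /subsetP]; apply.
  exact: subsetP (sub_others_of_flower _ _ ji) _ xZ.
have [i iP] := missed F' sF' cF'.
have /card_gt0P[v vT] : 0 < #|T_ i| by rewrite cT subn_gt0.
have : v \in core F'.
  apply/mem_core => M /iP[j ji /subsetP]; apply.
  by apply: subsetP vT; apply: flower_setD; rewrite // eq_sym.
have [w /andP[bw nbw]] := blU i v vT; have [M MG sM] := biclique_extend bw.
rewrite eqF' => /mem_core/(_ M); rewrite inE MG => vM.
case/negP: nbw; apply: (@biclique_sub _ _ M).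
  rewrite subUset sM sub1set vM //; apply/existsP; exists i.
  by apply: subset_trans sM; apply: subsetUr.
by case/max_bicliqueP: MG.
Qed.

Lemma blocked_of_critical : has_critical p q (max_bicliques G) ->
  exists s U T_, s < q /\ blocked_flower s U T_.
Proof.
case=> M critM; have := critical_flower_disjoint p_gt0 q_gt0 critM.
case=> s [U [T_ [ltsq cU [sTU cT dT] sUM dTM]]]; exists s, U, T_.
have MG i : M i \in max_bicliques G by have [] := critM i.
have bM i : biclique (M i) by case/max_bicliqueP: (MG i).
do 2!split=> //; first by move=> i; apply: biclique_sub (bM i).
(* The fixed vertex c of the odd triple comes from another petal, since the center of the flower may
   be empty. *)
move=> i v vT; have [j ji] := ord_neq i p_gt0.
have /card_gt0P[c cTj] : 0 < #|T_ j| by rewrite cT subn_gt0.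
have cU' : c \in U :\: T_ i by apply: subsetP cTj; apply: flower_setD.
have [w wM par] : exists2 w, w \in M i & parity c w v.
  apply: max_biclique_ext => //; first exact: (subsetP (sUM i)).
  by rewrite (disjointFr (dTM i)).
exists w; rewrite (@biclique_sub _ _ (M i)) //=; last by rewrite subUset sub1set wM sUM.
apply/nonbicliqueP; exists c, w, v; rewrite !inE !eqxx ?orbT; split=> //.
by rewrite -in_setD cU' !orbT.
Qed.

End Blocked.

(** * Critical systems in induced subgraphs *)

Section Hereditary.
Variables (G : sgraph) (p q : nat).
Hypotheses (p_gt0 : 0 < p) (q_gt0 : 0 < q).

Lemma parity_of_critical (M : 'I_p.+1 -> {set G}) :
  critical q (max_bicliques G) M -> exists x y z : G, parity x y z.
Proof.
move=> critM; have : ~~ biclique [set: G].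
  apply/negP => bG; have [j j0] := ord_neq (@ord0 p) p_gt0.
  have MT i : M i = setT.
    have [/max_bicliqueP[_ maxM] _ _] := critM i.
    by rewrite -(maxM _ bG (subsetT _)).
  by case/negP: j0; apply/eqP/(critical_inj critM); rewrite !MT.
by case/nonbicliqueP=> x [y [z [_ _ _ par]]]; exists x, y, z.
Qed.

(** Extend each N_i to a maximal biclique of [G]: by maximality of N_i its trace on X is still N_i,
    so criticality carries over. *)
Lemma critical_of_induced (X : {set G}) :
    has_critical p q (max_bicliques (induced X)) ->
  has_critical p q (max_bicliques G).
Proof.
case=> N critN.
have /fin_all_exists2[M MG sNM] i :
    exists2 M, M \in max_bicliques G & [set val x | x in N i] \subset M.
  apply: biclique_extend; rewrite biclique_val.
  by have [/max_bicliqueP[]] := critN i.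
have NM i u : (val u \in M i) = (u \in N i).
  apply/idP/idP => [uM|uN]; last by apply: (subsetP (sNM i)); apply: imset_f.
  have [/max_bicliqueP[_ maxN] _ _] := critN i.
  rewrite -(maxN [set u | val u \in M i]) ?inE //.
    rewrite -biclique_val (@biclique_sub _ _ (M i)) //.
      by apply/subsetP=> _ /imsetP[x + ->]; rewrite inE.
    by case/max_bicliqueP: (MG i).
  by apply/subsetP=> x xN; rewrite inE; apply: (subsetP (sNM i)); apply: imset_f.
have oNM i u : u \in others N i -> val u \in others M i.
  by move=> /mem_others uN; apply/mem_others => j ji; rewrite NM uN.
exists M => i; have [_ leq /subsetPn[x xo xN]] := critN i; split=> //.
  rewrite (leq_trans leq) // -(card_imset _ val_inj) subset_leq_card //.
  by apply/subsetP=> _ /imsetP[u uo ->]; apply: oNM.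
by apply/subsetPn; exists (val x); rewrite ?oNM ?NM.
Qed.

(** On the three vertices of an odd triple every pair is a biclique but the whole is not. A vertex
    common to all maximal bicliques, joined to the other two, would make it one. *)
Lemma not_hereditary_of_parity (x y z : G) :
  parity x y z -> ~ hereditary_biclique_Helly 1 1 G.
Proof.
move=> par; pose X := [set x; y; z] => /(_ X) HX.
have cX : #|{: induced X}| = 3.
  by rewrite card_sig -(parity_card par); apply: eq_card => u; rewrite !inE.
have nbX : ~~ biclique [set: induced X].
  rewrite -biclique_val; apply/nonbicliqueP; exists x, y, z.
  have XP u : u \in X -> u \in [set val v | v in [set: induced X]].
    by move=> uX; apply/imsetP; exists (Sub u uX).
  by split=> //; apply: XP; rewrite !inE eqxx ?orbT.
have max_neq0 M : M \in max_bicliques (induced X) -> M != set0.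
  case/max_bicliqueP => _ maxM.
  have /card_gt0P[u _] : 0 < #|{: induced X}| by rewrite cX.
  apply/eqP => M0; have := maxM [set u] (biclique1 u); rewrite M0 sub0set.
  by move=> /(_ isT)/setP/(_ u); rewrite !inE eqxx.
have [|M0 M0G _] := @biclique_extend (induced X) set0.
  by apply: biclique_card2; rewrite cards0.
have : 1 <= #|core (max_bicliques (induced X))|.
  apply: HX => //; first by apply/set0Pn; exists M0.
  move=> F sF F_neq0 cF; have /cards1P[M FM] : #|F| == 1.
    by rewrite eqn_leq cF card_gt0.
  rewrite card_gt0 FM /core big_set1; apply: max_neq0.
  by apply: (subsetP sF); rewrite FM set11.
case/card_gt0P=> u /mem_core uM.
have [|M MG sM] := @biclique_extend _ (~: [set u]).
  by apply: biclique_card2; rewrite cardsC1 cX.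
case/negP: nbX; have -> : setT = M; last by case/max_bicliqueP: MG.
apply/esym/eqP; rewrite eqEsubset subsetT /=; apply/subsetP => v _.
have [->|vu] := eqVneq v u; first exact: uM.
by apply: (subsetP sM); rewrite !inE.
Qed.

Lemma not_hereditary_of_critical : has_critical p q (max_bicliques G) ->
  ~ hereditary_biclique_Helly p q G.
Proof.
case=> M critM.
have MG i : M i \in max_bicliques G by have [] := critM i.
have bM i : biclique (M i) by case/max_bicliqueP: (MG i).
(* For p = q = 1 the deletion below may leave no vertex to serve as c: S may be empty and there is
   no third member. *)
have [/andP[/eqP p1 /eqP q1]|pq1] := boolP ((p == 1) && (q == 1)).
  have [x [y [z par]]] := parity_of_critical critM.
  by rewrite p1 q1; apply: not_hereditary_of_parity par.
pose K := \bigcap_i M i.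
have KM i : K \subset M i by apply: bigcap_inf.
have Ko i : K = M i :&: others M i.
  apply/setP=> x; rewrite inE; apply/bigcapP/andP => [xK|[xi /mem_others xo] j _].
    by split; [apply: xK | apply/mem_others => j _; apply: xK].
  by have [->//|] := eqVneq j i; apply: xo.
have [S sSK cS] := subset_of_card (geq_minl #|K| q.-1).
have cSq : #|S| < q by rewrite cS -[X in _ < X](prednK q_gt0) ltnS geq_minr.
have S_K : K :\: S = set0 \/ #|S| = q.-1 /\ q <= #|K|.
  have [ltKq|leqK] := ltnP #|K| q.
    left; apply/eqP; rewrite setD_eq0 -(geq_leqif (subset_leqif_card sSK)) cS.
    by rewrite leq_min leqnn -ltnS (prednK q_gt0).
  by right; rewrite cS (minn_idPr _) // (leq_trans (leq_pred _)).
pose X := (\bigcup_i M i) :\: (K :\: S).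
have MX i x : x \in M i -> x \notin K :\: S -> x \in X.
  by move=> xM xK; rewrite inE xK; apply/bigcupP; exists i.
have witness i v : v \in X -> v \notin M i ->
    exists c w, [/\ c \in M i :&: X, w \in M i :&: X & parity c w v].
  rewrite inE => /andP[_ /bigcupP[j _ vj]] vi.
  have ji : j != i by apply: contraNneq vi => <-.
  case: S_K => [K0|[cSq1 leqK]].
    have [_ leqo _] := critM j.
    have /card_gt0P[c co] : 0 < #|others M j| := leq_trans q_gt0 leqo.
    have cM : c \in M i by apply: (subsetP (others_sub M _)) co; rewrite eq_sym.
    have [w wM par] := max_biclique_ext (MG i) cM vi.
    by exists c, w; split=> //; rewrite inE ?cM ?wM (MX i) // K0 inE.
  (* The vertex c must survive and lie in both M_i and M_j. A point of S serves if q > 1; if q = 1,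
     a private point of a third member M_k does. *)
  have [c cX [ci cj]] : exists2 c, c \in X & c \in M i /\ c \in M j.
    have [q1|q_neq1] := eqVneq q 1.
      have p_gt1 : 1 < p.
        by move: pq1; rewrite q1 eqxx andbT ltn_neqAle p_gt0 andbT eq_sym.
      have [k /andP[ki kj]] := ord_neq2 i j p_gt1.
      have [_ _ /subsetPn[c ck cNk]] := critM k; exists c.
        apply: (MX i); first by apply: subsetP (others_sub M _) _ ck; rewrite eq_sym.
        by rewrite inE (contraNF (subsetP (KM k) c) cNk) andbF.
      by split; apply: subsetP (others_sub M _) _ ck; rewrite eq_sym.
    have /card_gt0P[c cinS] : 0 < #|S|.
      by rewrite cSq1 -subn1 subn_gt0 ltn_neqAle eq_sym q_neq1.
    have cK := subsetP sSK c cinS.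
    exists c; last by split; apply: (subsetP (KM _)).
    by apply: (MX i); [apply: (subsetP (KM i))|rewrite inE cinS].
  have [w wM par] := max_biclique_ext (MG i) ci vi.
  exists c, w; rewrite inE ci cX inE wM; split=> //; apply: (MX i) => //.
  (* The vertex w survives as well: a point of K lies in M_j together with c and v, and M_j contains
     no odd triple. *)
  rewrite inE negb_and; apply/orP; right; apply: contraL par => wK.
  by rewrite (parity_biclique (bM j)) // (subsetP (KM j)).
pose N i := [set u : induced X | val u \in M i].
have valN i : [set val u | u in N i] = M i :&: X.
  apply/setP=> x; rewrite inE; apply/imsetP/andP => [[u + ->]|[xM xX]].
    by rewrite inE => ->; split=> //; apply: valP.
  by exists (Sub x xX : induced X); rewrite ?inE.
have valo i : [set val u | u in others N i] = others M i :&: X.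
  apply/setP=> x; rewrite inE; apply/imsetP/andP => [[u /mem_others uo ->]|[/mem_others xo xX]].
    by split; [apply/mem_others => j /uo; rewrite inE|apply: valP].
  by exists (Sub x xX : induced X) => //; apply/mem_others => j /xo; rewrite inE.
have critN : critical q (max_bicliques (induced X)) N.
  move=> i; have [_ leqo nso] := critM i; split.
  - apply/max_bicliqueP; split.
      by rewrite -biclique_val valN (biclique_sub (subsetIl _ _)).
    move=> B bB sNB; apply/eqP; rewrite eqEsubset sNB andbT.
    apply/subsetP => u uB; rewrite inE; apply: contraLR bB => uM.
    have [c [w [cM wM par]]] := witness i _ (valP u) uM.
    rewrite -biclique_val; apply/nonbicliqueP; exists c, w, (val u).
    have sMB : M i :&: X \subset [set val u | u in B] by rewrite -valN imsetS.
    by split=> //; [apply: (subsetP sMB)|apply: (subsetP sMB)|apply: imset_f].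
  - rewrite -(card_imset _ val_inj) valo.
    have -> : others M i :&: X = others M i :\: (K :\: S).
      have [j ji] := ord_neq i p_gt0.
      by rewrite setIDA (setIidPl _) // (subset_trans (others_sub M ji)) // (bigcup_sup j).
    case: S_K => [->|[cSq1 leqK]]; first by rewrite setD0.
    have sKo : K \subset others M i by rewrite (Ko i) subsetIr.
    rewrite cardsD (setIidPr _) ?(subset_trans (subsetDl _ _)) // cardsD (setIidPr sSK).
    (* Since K is properly contained in [others M i], deleting #|K| - (q-1) points leaves at least
       q. *)
    have ltKo : #|K| < #|others M i|.
      by rewrite proper_card // properE sKo (Ko i) subsetI negb_and nso.
    rewrite cSq1 subnBA; last exact: leq_trans (leq_pred _) leqK.
    rewrite -[X in X <= _](prednK q_gt0) -addn1 addnC.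
    by rewrite leq_subRL ?addnA ?leq_add2r ?addn1 // ltnW // ltn_addr.
  - have /subsetPn[x xo xM] := nso.
    have xX : x \in X.
      have [j ji] := ord_neq i p_gt0.
      apply: (MX j); first exact: subsetP (others_sub M ji) _ xo.
      by rewrite inE (contraNF (subsetP (KM i) x) xM) andbF.
    have : x \in [set val u | u in others N i] by rewrite valo inE xo xX.
    case/imsetP=> u uo xu; apply/subsetPn; exists u => //.
    by rewrite inE -xu.
move=> /(_ X)/(_ _ (critical_family_sub critN) (critical_family_neq0 N)).
rewrite leqNgt => /(_ _)/negP[].
  by apply: (critical_intersecting critN) => i; have [] := critN i.
rewrite (core_critical_family _ ord0) (leq_ltn_trans _ cSq) // -(card_imset _ val_inj).
apply/subset_leq_card/subsetP => _ /imsetP[u + ->]; rewrite inE => /andP[uN uo].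
have uK : val u \in K.
  rewrite (Ko ord0) inE; move: uN; rewrite inE => -> /=.
  have : val u \in [set val u | u in others N ord0] by apply: imset_f.
  by rewrite valo inE => /andP[].
have : val u \in X := valP u.
by rewrite inE => /andP[+ _]; rewrite inE uK andbT negbK.
Qed.

End Hereditary.

(** * Bioculars *)

Section BiocularTransfer.
Implicit Types G H K : sgraph.

Lemma iso_embedding G (X : {set G}) H : sgraph_iso (induced X) H ->
  exists h : H -> G, injective h /\ forall x y, adj (h x) (h y) = adj x y.
Proof.
case=> f [[g fK gK] f_adj]; exists (fun x => val (g x)).
split=> [x y /val_inj/(can_inj gK)//|x y].
by rewrite -[adj (val _) _]/(adj (g x) (g y)) -f_adj !gK.
Qed.

Lemma induced_of_embedding G H (h : H -> G) :
    injective h -> (forall x y, adj (h x) (h y) = adj x y) ->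
  exists X : {set G}, sgraph_iso (induced X) H.
Proof.
move=> h_inj h_adj; pose X := [set h x | x in [set: H]]; exists X.
have hX x : h x \in X by apply: imset_f.
pose g x : induced X := Sub (h x) (hX x).
have g_inj : injective g by move=> x y /(congr1 val)/h_inj.
have [|f gK fK] := inj_card_bij g_inj.
  by rewrite card_sig -cardsT -(card_imset _ h_inj) subset_leq_card //; apply/subsetP=> x.
exists f; split; first by exists g.
by move=> x y; rewrite -h_adj -{2}[x]fK -{2}[y]fK.
Qed.

Lemma parity_of_small_biocular H :
  sgraph_iso H (complement (path_graph 3)) \/ sgraph_iso H (complete_graph 3) ->
  exists x y z : H, parity x y z.
Proof.
pose i0 : 'I_3 := @Ordinal 3 0 isT; pose i1 : 'I_3 := @Ordinal 3 1 isT.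
pose i2 : 'I_3 := @Ordinal 3 2 isT.
by case=> -[f [[g fK gK] f_adj]]; exists (g i0), (g i1), (g i2);
   rewrite /parity -!f_adj !gK.
Qed.

Lemma small_biocular_of_parity G (x y z : G) : parity x y z ->
  exists (X : {set G}) H, biocular 1 1 0 H /\ sgraph_iso (induced X) H.
Proof.
have embed (a b c : G) : #|[set a; b; c]| = 3 ->
    injective (fun i : 'I_3 => nth a [:: a; b; c] i).
  move=> c3 i j /eqP; rewrite nth_uniq //; first by move/eqP/val_inj.
  apply/card_uniqP; rewrite /= -c3; apply: eq_card => u; rewrite !inE.
  by rewrite orbA.
(* In the complement of the path 0-1-2 the isolated vertex is the middle one, so the only edge joins
   a and c. *)
have oneP3 (a b c : G) : parity a b c -> adj a c -> ~~ adj a b -> ~~ adj b c ->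
    exists (X : {set G}) H, biocular 1 1 0 H /\ sgraph_iso (induced X) H.
  move=> /parity_card/embed h_inj ac ab bc.
  have [|X isoX] := @induced_of_embedding G (complement (path_graph 3)) _ h_inj.
    case=> [[|[|[|//]]] ?] [[|[|[|//]]] ?] /=;
    by rewrite ?adj_irr ?(negPf ab) ?(negPf bc) ?ac // adj_sym ?(negPf ab) ?(negPf bc) ?ac.
  exists X, (complement (path_graph 3)); split=> //; split=> //; left.
  by exists id; split=> //; exists id.
move=> par; have := par; rewrite /parity.
have [xy|xy] := boolP (adj x y); have [yz|yz] := boolP (adj y z);
  have [xz|xz] := boolP (adj x z) => // _.
- have h_inj := embed _ _ _ (parity_card par).
  have [|X isoX] := @induced_of_embedding G (complete_graph 3) _ h_inj.
    case=> [[|[|[|//]]] ?] [[|[|[|//]]] ?] /=;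
    by rewrite ?adj_irr ?xy ?yz ?xz // adj_sym ?xy ?yz ?xz.
  exists X, (complete_graph 3); split=> //; split=> //; right.
  by exists id; split=> //; exists id.
- by apply: (oneP3 x z y); rewrite 1?parity_swapr 1?(adj_sym z y).
- by apply: (oneP3 y x z); rewrite 1?parity_swapl 1?(adj_sym y x).
- exact: (oneP3 x y z).
Qed.

Lemma blocked_of_parity G (x y z : G) :
  parity x y z -> exists U T_, @blocked_flower G 1 1 0 U T_.
Proof.
move=> par; have c3 := parity_card par.
have xy : x != y by apply: contraTneq par => ->; rewrite parity_swapr parity_swapl parityxx.
pose T_ (i : 'I_2) := if i == ord0 then [set x] else [set y].
have sTU i : T_ i \subset [set x; y].
  by rewrite /T_; case: eqP; rewrite sub1set !inE eqxx ?orbT.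
have cT i : #|T_ i| = 1 by rewrite /T_; case: eqP; rewrite cards1.
have cUT i : #|[set x; y] :\: T_ i| = 1 by rewrite cardsD (setIidPr (sTU i)) cT cards2 xy.
exists [set x; y], T_; split.
- by rewrite cards2 xy.
- split=> // i j; rewrite /T_ -(inj_eq val_inj).
  case: i j => [[|[|//]] ?] [[|[|//]] ?] //= _; rewrite disjoints1 inE //.
  by rewrite eq_sym.
- by move=> i; apply: biclique_card2; rewrite cUT.
- move=> i v vT; exists z; apply/andP; split.
    apply: biclique_card2; rewrite (leq_trans (leq_card_setU _ _).1) //.
    by rewrite cards1 cUT.
  apply/nonbicliqueP; exists x, y, z.
  have sU u : u \in [set x; y] -> u \in v |: (z |: ([set x; y] :\: T_ i)).
    move=> uU; rewrite 2!in_setU1 in_setD uU andbT.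
    have [//|uv] := eqVneq u v; apply/orP; right.
    have /cards1P[t Tt] : #|T_ i| == 1 by rewrite cT.
    by move: vT; rewrite Tt !inE => /eqP <-; rewrite uv orbT.
  by split=> //; [apply: sU | apply: sU |]; rewrite !inE eqxx ?orbT.
Qed.

Lemma blocked_of_biocular G (X : {set G}) H p q s :
    0 < p -> s < q -> biocular p q s H -> sgraph_iso (induced X) H ->
  exists U T_, @blocked_flower G p q s U T_.
Proof.
move=> p_gt0 ltsq + /iso_embedding[h [h_inj h_adj]]; rewrite /biocular.
case: ifP => [/andP[/eqP-> /eqP->] [-> /parity_of_small_biocular[x [y [z par]]]]|_].
  by apply: (@blocked_of_parity _ (h x) (h y) (h z)); rewrite /parity !h_adj.
case=> U [W [T_ [_ _ cU [sTU cT dT] beta]]].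
have hD (A B : {set H}) : h @: A :\: h @: B = h @: (A :\: B).
  apply/setP=> x; rewrite !inE; apply/andP/imsetP => [[xB /imsetP[u uA xu]]|[u + ->]].
    by exists u => //; rewrite inE uA andbT; apply: contra xB => uB; rewrite xu imset_f.
  by rewrite inE !mem_imset // => /andP.
have bic (A : {set H}) : biclique (h @: A) = biclique A by apply: biclique_imset.
exists (h @: U), (fun i => h @: T_ i); split.
- by rewrite card_imset.
- by split=> [i|i|i j ij]; rewrite ?imsetS ?card_imset // imset_disjoint ?dT.
- move=> i; rewrite hD bic.
  case: beta => [[_ _ /(_ i)[]//]|[_ _ bU _]].
  exact: biclique_sub (subsetDl _ _) bU.
move=> i _ /imsetP[v vT ->].
case: beta => [[_ _ /(_ i)[bU nb] _]|[_ _ _ [w [_ _ /(_ i)[bw nb]]]]]; last first.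
  by exists (h (w i)); rewrite hD -!imsetU1 !bic bw setUCA nb.
(* In the remaining case, beta_1, no outside vertex is at hand; a vertex of U - T_i serves as the
   blocking w, and adding it changes nothing. *)
have [j ji] := ord_neq i p_gt0.
have /card_gt0P[c cTj] : 0 < #|T_ j| by rewrite cT subn_gt0.
have cU' : c \in U :\: T_ i.
  by rewrite inE (subsetP (sTU j)) // (disjointFr (dT _ _ ji)).
exists (h c); rewrite hD -!imsetU1 !bic.
have -> : c |: (U :\: T_ i) = U :\: T_ i by apply/setUidPr; rewrite sub1set.
by rewrite bU nb.
Qed.

Lemma biocular_of_subset G p q s (U W : {set G}) (T_ : 'I_p.+1 -> {set G}) :
    ~~ ((p == 1) && (q == 1)) ->
    [disjoint U & W] -> #|U| = p.+1 * (q - s) + s ->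
    [/\ forall i, T_ i \subset U, forall i, #|T_ i| = q - s
      & pairwise_disjoint T_] ->
    beta1 s U W T_ \/ beta2 q U W T_ ->
  exists (X : {set G}) H, biocular p q s H /\ sgraph_iso (induced X) H.
Proof.
move=> /negbTE pq1 dUW cU [sTU cT dT] beta; pose X := U :|: W.
exists X, (induced X); split; last by exists id; split=> //; exists id.
have sUX : U \subset X by apply: subsetUl.
have sTX i : T_ i \subset X by apply: subset_trans sUX.
pose P (A : {set G}) := [set u : induced X | val u \in A].
have valP_ (A : {set G}) : A \subset X -> [set val u | u in P A] = A.
  move=> /subsetP sAX; apply/setP=> x; apply/imsetP/idP => [[u + ->]|xA].
    by rewrite inE.
  by exists (Sub x (sAX x xA) : induced X); rewrite ?inE.
have bP (A : {set G}) : A \subset X -> biclique (P A) = biclique A.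
  by move=> sAX; rewrite -biclique_val valP_.
have cP (A : {set G}) : A \subset X -> #|P A| = #|A|.
  by move=> sAX; rewrite -(card_imset _ val_inj) valP_.
have PD A B : P A :\: P B = P (A :\: B) by apply/setP=> u; rewrite !inE.
have PU1 u A : u |: P A = P (val u |: A).
  by apply/setP=> v; rewrite !inE (inj_eq val_inj).
have sUT i : U :\: T_ i \subset X by rewrite (subset_trans (subsetDl _ _)).
have sU1 (u : induced X) (A : {set G}) : A \subset X -> val u |: A \subset X.
  by move=> sA; rewrite subUset sub1set sA (valP u).
rewrite /biocular pq1; exists (P U), (P W), (fun i => P (T_ i)); split.
- by apply/setP=> u; rewrite !inE -in_setU; apply: valP u.
- rewrite disjoint_subset; apply/subsetP=> u; rewrite !inE => uU.
  by rewrite (disjointFr dUW).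
- by rewrite cP.
- split=> [i|i|i j ij]; last 2 first.
  + by rewrite cP.
  + rewrite disjoint_subset; apply/subsetP=> u; rewrite !inE => uT.
    by rewrite (disjointFr (dT _ _ ij)).
  by apply/subsetP=> u; rewrite !inE; apply: subsetP.
case: beta => [[p12 W0 bT ps]|[p2 pq bU [w [w_inj Ww bw]]]]; [left|right].
  split=> //; first by apply/setP=> u; rewrite W0 !inE.
  move=> i; have [bi nb] := bT i; rewrite PD bP //; split=> // v.
  by rewrite inE PU1 bP ?sU1 //; apply: nb.
split=> //; first by rewrite bP.
have wX i : w i \in X by rewrite inE Ww imset_f ?orbT.
exists (fun i => Sub (w i) (wX i)); split.
- by move=> i j /(congr1 val)/w_inj.
- apply/setP=> u; rewrite inE Ww; apply/imsetP/imsetP => -[i _ ui]; exists i => //.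
    exact: val_inj.
  by rewrite ui.
move=> i; have [bi nb] := bw i; rewrite PD PU1 bP ?sU1 //; split=> // v.
by rewrite inE !PU1 bP ?sU1 //; apply: nb.
Qed.

End BiocularTransfer.

(** * Extracting bioculars *)

Section BiocularExistence.
Variable G : sgraph.

Let contains_biocular p q := exists2 s, s < q &
  exists (X : {set G}) H, biocular p q s H /\ sgraph_iso (induced X) H.

Lemma pair_others (M : 'I_2 -> {set G}) i : others M i = M (rev_ord i).
Proof.
apply/setP=> x; apply/mem_others/idP => [xM|xM j ji].
  by apply: xM; case: i => [[|[|//]] ?].
suff -> : j = rev_ord i by [].
by apply/val_inj; move: i j ji {xM} => [[|[|//]] ?] [[|[|//]] ?].
Qed.

(* Two maximal bicliques of size at least q with largest intersection K:
   if |K| < q, a biclique containing a q-subset of one of them and a further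
   vertex would extend to a maximal biclique meeting it in more than |K|
   vertices. *)
Lemma biocular1_of_critical q : 1 < q -> has_critical 1 q (max_bicliques G) ->
  contains_biocular 1 q.
Proof.
move=> q_gt1 [M0 critM0].
pose P (M : {ffun 'I_2 -> {set G}}) := (M ord0 != M ord_max) &&
  [forall i, (M i \in max_bicliques G) && (q <= #|M i|)].
have PM0 : P [ffun i => M0 i].
  apply/andP; split; first by rewrite !ffunE (inj_eq (critical_inj critM0)).
  apply/forallP=> i; rewrite ffunE; have [-> _ _] := critM0 i.
  have [_ + _] := critM0 (rev_ord i); by rewrite pair_others rev_ordK.
have [M /andP[neqM /forallP PM] maxK] :=
  arg_maxnP (fun M : {ffun 'I_2 -> {set G}} => #|M ord0 :&: M ord_max|) PM0.
have MG i : M i \in max_bicliques G by case/andP: (PM i).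
have leqM i : q <= #|M i| by case/andP: (PM i).
have bM i : biclique (M i) by case/max_bicliqueP: (MG i).
have I2 (i : 'I_2) : i = ord0 \/ i = ord_max.
  by case: i => [[|[|//]] ?]; [left|right]; apply: val_inj.
have nsubM (i j : 'I_2) : i != j -> ~~ (M i \subset M j).
  move=> ij; have : M i != M j.
    by case: (I2 i) (I2 j) ij => -> [] -> // _; rewrite eq_sym.
  apply: contra => sij.
  by case/max_bicliqueP: (MG i) => _ /(_ _ (bM j) sij) ->.
have critM : critical q (max_bicliques G) (M : 'I_1.+1 -> {set G}).
  move=> i; rewrite pair_others; split=> //; apply: nsubM.
  by case: (I2 i) => ->.
have pq1 : ~~ ((1 == 1) && (q == 1)) by rewrite eqxx gtn_eqF.
have dW (A : {set G}) : [disjoint A & set0] by rewrite disjoint_sym disjoints_subset sub0set.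
have [ltKq|leqK] := ltnP #|M ord0 :&: M ord_max| q.
  have [//|//|s [U [T_ [ltsq cU [sTU cT dT] sUM dTM]]]] :=
    critical_flower_disjoint _ _ critM; first exact: ltnW.
  exists s => //; apply: (biocular_of_subset (U := U) (W := set0) (T_ := T_)) => //.
  left; split=> //; [by left| |by left] => i.
  split=> [|v vT]; first exact: biclique_sub (sUM i) (bM i).
  apply/negP => /biclique_extend[L LG sL].
  have cUT : #|U :\: T_ i| = q.
    by rewrite cardsD (setIidPr (sTU i)) cU cT mulSn mul1n -addnA addKn subnK // ltnW.
  have sUL : U :\: T_ i \subset L by apply: subset_trans sL; apply: subsetUr.
  have vL : v \in L by rewrite (subsetP sL) // setU11.
  have PL : P [ffun j => if j == ord0 then M i else L].
    apply/andP; split.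
      by rewrite !ffunE /=; apply: contraTneq vL => <-; rewrite (disjointFr (dTM i)).
    apply/forallP=> j; rewrite ffunE; case: ifP => _; first by rewrite MG leqM.
    by rewrite LG -cUT subset_leq_card.
  have := maxK _ PL; rewrite /= !ffunE /= leqNgt (leq_trans ltKq) //.
  by rewrite -cUT subset_leq_card // subsetI sUM.
(* If the intersection has at least q points, take s = q-1 and single-vertex petals b and a. As q >
   1, some c lies in S0; maximality of M_0 gives an odd triple c, a, b, and a is outside the other
   biclique because b and c are inside it. *)
have [|S0 sS0 cS0] := @subset_of_card _ (M ord0 :&: M ord_max) q.-1.
  exact: leq_trans (leq_pred _) leqK.
have q1E : q - q.-1 = 1 by rewrite -[X in X - _](ltn_predK q_gt1) subSnn.
have /card_gt0P[c cS] : 0 < #|S0| by rewrite cS0 -subn1 subn_gt0.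
have /subsetPn[b bM1 bM0] : ~~ (M ord_max \subset M ord0) by apply: nsubM.
have S0M i : S0 \subset M i.
  by apply: subset_trans sS0 _; case: (I2 i) => ->; rewrite ?subsetIl ?subsetIr.
have [a aM0 par] := max_biclique_ext (MG ord0) (subsetP (S0M _) _ cS) bM0.
have aM1 : a \notin M ord_max.
  apply: contraL par => aM1.
  by rewrite (parity_biclique (bM ord_max)) // (subsetP (S0M _)).
have ab : a != b by apply: contraNneq aM1 => ->.
pose t (i : 'I_2) := if i == ord0 then b else a.
have m0 : (ord_max == ord0 :> 'I_2) = false by [].
pose U := a |: (b |: S0).
have tU i : t i \in U by rewrite /t !inE; case: ifP; rewrite eqxx ?orbT.
exists q.-1; first by rewrite (ltn_predK q_gt1).
apply: (biocular_of_subset (U := U) (W := set0) (T_ := fun i => [set t i])) => //.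
- rewrite q1E !cardsU1 cS0 in_setU1 negb_or ab.
  rewrite (contra (subsetP (S0M _) a) aM1) (contra (subsetP (S0M _) b) bM0).
  by rewrite !add1n.
- split=> [i|i|i j]; rewrite ?sub1set ?cards1 //.
  rewrite disjoints1 inE /t.
  by case: (I2 i) (I2 j) => -> [] ->; rewrite ?eqxx //= eq_sym.
left; split=> //; [by left| |by left] => i; split=> [|v].
  apply: biclique_sub (bM i); apply/subsetP=> x; rewrite !inE /t.
  case/andP=> xt /or3P[/eqP xE|/eqP xE|]; last exact: (subsetP (S0M i)).
    by move: xt; rewrite xE; case: (I2 i) => ->; rewrite ?m0 ?eqxx ?aM0.
  by move: xt; rewrite xE; case: (I2 i) => ->; rewrite ?m0 ?eqxx ?bM1.
rewrite inE => /eqP ->; rewrite setD1K //; apply/nonbicliqueP.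
by exists c, a, b; rewrite !inE !eqxx cS ?orbT.
Qed.

Section Large.
Variables p q s : nat.
Variables (U : {set G}) (T_ : 'I_p.+1 -> {set G}).
Hypotheses (p_gt1 : 1 < p) (ltsq : s < q).
Hypothesis blU : blocked_flower q s U T_.

Let p_gt0 : 0 < p := ltnW p_gt1.

(** Two points meet at most two of the at least three disjoint petals. So any two points of U lie in
    a common biclique U - T_k. *)
Lemma avoid_petal x y : exists k, (x \notin T_ k) && (y \notin T_ k).
Proof.
have [_ [_ _ dT] _ _] := blU.
have nin i k z : z \in T_ i -> k != i -> z \notin T_ k.
  by move=> zT ki; rewrite (disjointFl (dT _ _ ki)).
have [/existsP[i xi]|/existsPn nx] := boolP [exists i, x \in T_ i]; last first.
  have [/existsP[j yj]|/existsPn ny] := boolP [exists i, y \in T_ i].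
    by have [k kj] := ord_neq j p_gt0; exists k; rewrite nx (nin j).
  by exists ord0; rewrite nx ny.
have [/existsP[j yj]|/existsPn ny] := boolP [exists i, y \in T_ i].
  have [k /andP[ki kj]] := ord_neq2 i j p_gt1.
  by exists k; rewrite (nin i) ?(nin j).
by have [k ki] := ord_neq i p_gt0; exists k; rewrite (nin i) ?ny.
Qed.

Lemma parity_core c x y : c \in U :\: \bigcup_i T_ i -> x \in U -> y \in U ->
  parity c x y = false.
Proof.
have [_ _ bU _] := blU; rewrite inE => /andP[cT cU] xU yU.
have [k /andP[xk yk]] := avoid_petal x y.
apply: parity_biclique (bU k) _ _ _; rewrite inE ?xk ?yk //.
by rewrite cU andbT; apply: contra cT => ck; apply/bigcupP; exists k.
Qed.

(* A nonbiclique triple in U must hit every petal, so p + 1 <= 3; the parity of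
   a transversal triple does not change when one of its points moves within
   its petal. *)
Lemma nonbiclique_flower : ~~ biclique U ->
  [/\ p = 2, s = 0 & forall i v, v \in T_ i -> ~~ biclique (v |: (U :\: T_ i))].
Proof.
have [cU [sTU cT dT] bU _] := blU.
case/nonbicliqueP=> x [y [z [xU yU zU par]]].
have s0 : s = 0.
  apply/eqP; rewrite -leqn0 leqNgt; apply/negP => s_gt0.
  have : 0 < #|U :\: \bigcup_i T_ i|.
    rewrite card_gt0 setD_eq0; apply: contraTN s_gt0 => sUT.
    have := subset_leq_card sUT; rewrite cU -[\bigcup_i T_ i]set0U.
    rewrite (card_sunflower (r := q - s)) // => [|i]; last by rewrite disjoints_subset sub0set.
    by rewrite cards0 leq_add2l leqn0 -eqn0Ngt.
  case/card_gt0P=> c cS; move: par.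
  by rewrite (parity_cocycle c) !parity_core.
have hit k : exists2 e, e \in T_ k & e \in [set x; y; z].
  have [/exists_inP//|/exists_inPn no] := boolP [exists e in T_ k, e \in [set x; y; z]].
  have out e : e \in [set x; y; z] -> e \notin T_ k by apply: contraL; apply: no.
  by move: par; rewrite (parity_biclique (bU k)) // inE out ?inE ?eqxx ?orbT.
have p2 : p = 2.
  apply/eqP; rewrite eqn_leq p_gt1 andbT -ltnS -(parity_card par).
  have /fin_all_exists2[f fT fxyz] := hit.
  have f_inj : injective f.
    move=> i j eqf; apply/eqP/negPn/negP => ij.
    by have := fT i; rewrite eqf (disjointFl (dT _ _ ij)).
  rewrite -[X in X <= _]card_ord -cardsT -(card_imset _ f_inj) subset_leq_card //.
  by apply/subsetP=> _ /imsetP[i _ ->].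
split=> // i v vT.
(* The triple meets T_i only in a, since two of its points in one petal would leave all three in
   some U - T_k. For the same reason triples containing both a and v are even, and the cocycle
   identity moves a to v. *)
have main a b c : a \in U -> b \in U -> c \in U -> parity a b c -> a \in T_ i ->
    ~~ biclique (v |: (U :\: T_ i)).
  move=> aU bU' cU' par' aT.
  have notT d e : d \in U -> e \in U -> parity a d e -> d \notin T_ i.
    move=> dU eU; apply: contraL => dTi; have [k /andP[ak ek]] := avoid_petal a e.
    rewrite (parity_biclique (bU k)) // inE ?ak ?ek //= dU andbT.
    by rewrite (disjointFr (dT i k _)) //; apply: contraNneq ak => <-.
  have bT := notT b c bU' cU' par'.
  have cT' : c \notin T_ i by apply: (notT c b) => //; rewrite parity_swapr.
  have vU := subsetP (sTU i) v vT.
  have av e : e \in U -> parity a v e = false.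
    move=> eU; have [k /andP[ak ek]] := avoid_petal a e.
    rewrite (parity_biclique (bU k)) // inE ?ak ?ek //= vU andbT.
    by rewrite (disjointFr (dT i k _)) //; apply: contraNneq ak => <-.
  apply/nonbicliqueP; exists v, b, c; split; rewrite ?setU11 // ?in_setU1 ?in_setD.
  - by rewrite bT bU' orbT.
  - by rewrite cT' cU' orbT.
  - by rewrite (parity_cocycle a) !av // addbF par'.
have [e eT] := hit i; rewrite !inE -orbA => /or3P[]/eqP eqe; rewrite {e}eqe in eT.
- exact: (main x y z).
- by apply: (main y x z) => //; rewrite parity_swapl.
- by apply: (main z x y) => //; rewrite parity_swapl parity_swapr.
Qed.

Section BicliqueUnion.
Hypothesis bU : biclique U.
Variable w : 'I_p.+1 -> G.
Hypothesis bw : forall i, biclique (w i |: (U :\: T_ i)).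

Let P i := [set v in T_ i | ~~ biclique (v |: (w i |: (U :\: T_ i)))].

Lemma petal_anchor i : exists c, c \in U :\: T_ i.
Proof.
have [_ [sTU cT dT] _ _] := blU; have [j ji] := ord_neq i p_gt0.
have /card_gt0P[c cTj] : 0 < #|T_ j| by rewrite cT subn_gt0.
by exists c; apply: subsetP cTj; apply: flower_setD.
Qed.

(** With an anchor c in U - T_i, only triples through c and w_i need checking; they are even for
    every vertex outside P_i. *)
Lemma compatible_biclique i : biclique (w i |: (U :\: P i)).
Proof.
have [c cU] := petal_anchor i.
have cUP : c \in U :\: P i.
  by move: cU; rewrite !inE => /andP[/negPf-> ->].
have bUP : biclique (U :\: P i) by apply: biclique_sub bU; apply: subsetDl.
have [//|/(nonbiclique_ext cUP bUP)[x]] := boolP (biclique (w i |: (U :\: P i))).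
rewrite inE parity_swapr => /andP[xP xU]; apply: contraTT => _.
have [xT|xT] := boolP (x \in T_ i).
  move: xP; rewrite inE xT /= negbK => bx.
  by rewrite (parity_biclique bx) // !in_setU1 ?eqxx ?cU ?orbT.
by rewrite (parity_biclique (bw i)) // !in_setU1 ?eqxx ?cU ?in_setD ?xT ?xU ?orbT.
Qed.

(** This permits shrinking U: any single remaining vertex c outside P_i still witnesses that w_i
    excludes v. *)
Lemma incompatible_parity i v c : v \in P i -> c \in U :\: P i -> parity c (w i) v.
Proof.
have [_ [sTU _ _] _ _] := blU; move=> vP cUP; have [c0 c0U] := petal_anchor i.
have [vT nb] : v \in T_ i /\ ~~ biclique (v |: (w i |: (U :\: T_ i))).
  by apply/andP; move: vP; rewrite inE.
have vU := subsetP (sTU i) v vT.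
have sU x : x \in U :\: T_ i -> x \in U by rewrite inE => /andP[].
have c0w : c0 \in w i |: (U :\: T_ i) by rewrite in_setU1 c0U orbT.
have par0 : parity c0 (w i) v.
  have [u] := nonbiclique_ext c0w (bw i) nb; rewrite in_setU1 => /orP[/eqP->//|uU].
  by rewrite (parity_biclique bU) // sU.
have c0P : c0 \in U :\: P i.
  by move: c0U; rewrite !inE => /andP[/negPf-> ->].
have cU : c \in U by move: cUP; rewrite inE => /andP[].
rewrite (parity_cocycle c0) par0.
rewrite (parity_biclique (compatible_biclique i));
  rewrite ?in_setU1 ?c0P ?cUP ?eqxx ?orbT //.
by rewrite (parity_biclique bU) // sU.
Qed.

End BicliqueUnion.

(* The vertices of T_i incompatible with w_i form the new petals, cut down to
   the size of a smallest one; the rest of that smallest petal joins the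
   center. *)
Lemma biocular_of_biclique : (p, q) <> (2, 1) -> biclique U -> contains_biocular p q.
Proof.
move=> pq21 bU; have [cU [sTU cT dT] _ blT] := blU.
have T_neq0 i : exists v, v \in T_ i by apply/card_gt0P; rewrite cT subn_gt0.
have /fin_all_exists[w wP] i : exists w, biclique (w |: (U :\: T_ i)) /\
    exists2 v, v \in T_ i & ~~ biclique (v |: (w |: (U :\: T_ i))).
  have [v vT] := T_neq0 i; have [w /andP[bw nb]] := blT i v vT.
  by exists w; split=> //; exists v.
have bw i := (wP i).1.
pose P i := [set v in T_ i | ~~ biclique (v |: (w i |: (U :\: T_ i)))].
have sPT i : P i \subset T_ i by apply/subsetP=> v; rewrite inE => /andP[].
have [i0 _ minP] := arg_minnP (P := predT) (fun i => #|P i|) (erefl : predT (@ord0 p)).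
set r := #|P i0| in minP.
have r_gt0 : 0 < r.
  case: (wP i0) => _ [v vT nb]; apply/card_gt0P; exists v; by rewrite inE vT.
have le_r : r <= q - s by rewrite -(cT i0) subset_leq_card.
have /fin_all_exists2[T' sTP cT'] i := subset_of_card (minP i isT).
have T'0 : T' i0 = P i0 by apply/eqP; rewrite eqEcard sTP cT' leqnn.
have sT'T i : T' i \subset T_ i by apply: subset_trans (sPT i).
have dT' : pairwise_disjoint T'.
  by move=> i j ij; apply: disjointWl (sT'T i) (disjointWr (sT'T j) (dT _ _ ij)).
(* The new center has s + (q-s-r) = q-r points, so the new value of s is q-r and the petals have the
   matching size r. *)
pose S' := (U :\: \bigcup_i T_ i) :|: (T_ i0 :\: P i0).
pose U' := S' :|: \bigcup_i T' i.
have dS' i : [disjoint S' & T' i].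
  rewrite disjoint_sym disjoint_subset; apply/subsetP=> x xT'.
  have xT := subsetP (sT'T i) x xT'; rewrite inE !in_setU !in_setD negb_or !negb_and.
  have -> /= : x \in \bigcup_i T_ i by apply/bigcupP; exists i.
  have [eqi|ne] := eqVneq i i0; first by rewrite -T'0 -eqi xT'.
  by rewrite (disjointFr (dT _ _ ne)) ?orbT.
have cS' : #|S'| = q - r.
  rewrite cardsU disjoint_setI0 ?cards0 ?subn0; last first.
    rewrite disjoint_sym disjoint_subset; apply/subsetP=> x.
    rewrite in_setD => /andP[_ xT]; rewrite inE in_setD negb_and negbK.
    by apply/orP; left; apply/bigcupP; exists i0.
  have cbT : #|\bigcup_i T_ i| = p.+1 * (q - s).
    rewrite -[\bigcup_i T_ i]set0U (card_sunflower (r := q - s)) ?cards0 ?addn0 // => i.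
    by rewrite disjoints_subset sub0set.
  rewrite !cardsD (setIidPr (sPT i0)) cT (setIidPr _) ?cbT ?cU; last exact/bigcupsP.
  by rewrite addKn addnBA // subnKC // ltnW.
have le_rq : r <= q by apply: leq_trans le_r (leq_subr _ _).
have sU'U : U' \subset U.
  rewrite !subUset subsetDl (subset_trans (subsetDl _ _)) //=.
  by apply/bigcupsP=> i _; apply: subset_trans (sTU i).
have sT'U' i : T' i \subset U' by rewrite subsetU // orbC (bigcup_sup i).
(* No vertex of P_i remains outside the new petal: the surplus of P_i is dropped from U', and the
   smallest P_i is kept whole as a petal. *)
have sU'P i : U' :\: T' i \subset U :\: P i.
  apply/subsetP=> x; rewrite !in_setD => /andP[xT' xU'].
  rewrite (subsetP sU'U x xU') andbT; apply/negP => xP; case/negP: xT'.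
  have xT := subsetP (sPT i) x xP; move: xU'; rewrite in_setU => /orP[|/bigcupP[j _ xj]].
    rewrite in_setU !in_setD => /orP[/andP[/bigcupP[]]|/andP[xP0 xT0]]; first by exists i.
    have [eqi|ne] := eqVneq i i0; first by rewrite -eqi xP in xP0.
    by rewrite (disjointFr (dT _ _ ne)) in xT0.
  have [<-//|ne] := eqVneq j i.
  by rewrite (disjointFr (dT _ _ ne)) // (subsetP (sT'T j)) in xT.
have wU i : w i \notin U.
  have [v vT'] : exists v, v \in T' i by apply/card_gt0P; rewrite cT'.
  have vP := subsetP (sTP i) v vT'.
  have [c cU'] := petal_anchor i; apply/negP => wU.
  have cUP : c \in U :\: P i by apply: subsetP cU'; apply: setDS.
  have := incompatible_parity bU bw vP cUP.
  rewrite (parity_biclique bU) //; first by move: cU'; rewrite inE => /andP[].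
  exact/(subsetP (sTU i))/(subsetP (sPT i)).
have anchor' i j : j != i -> exists2 c, c \in T' j & c \in U' :\: T' i.
  move=> ji; have [c cT'j] : exists v, v \in T' j by apply/card_gt0P; rewrite cT'.
  exists c => //; rewrite inE (subsetP (sT'U' j)) // andbT.
  by rewrite (disjointFr (dT' _ _ ji)).
exists (q - r); first by rewrite ltn_subrL r_gt0 (leq_trans r_gt0).
apply: (@biocular_of_subset G p q (q - r) U' [set w i | i in 'I_p.+1] T').
- by rewrite negb_and gtn_eqF.
- rewrite disjoint_sym disjoint_subset; apply/subsetP=> _ /imsetP[i _ ->].
  by rewrite inE; apply: contra (wU i); apply: (subsetP sU'U).
- by rewrite (card_sunflower (r := r)) // cS' subKn.
- by split=> // i; rewrite subKn.
right; split=> //; first exact: biclique_sub bU.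
exists w; split=> //.
  (* If w_i = w_j, take v in T'_i and c in a third petal: the triple c, w_i, v is odd, yet all of it
     lies in the biclique of w_j. *)
  move=> i j eqw; apply/eqP/negPn/negP => ij.
  have [k /andP[ki kj]] := ord_neq2 i j p_gt1.
  have [c cT'k cUi] := anchor' i k ki.
  have [v vT'] : exists v, v \in T' i by apply/card_gt0P; rewrite cT'.
  have := incompatible_parity bU bw (subsetP (sTP i) v vT') (subsetP (sU'P i) c cUi).
  have inUj l x : l != j -> x \in T' l -> x \in w j |: (U :\: P j).
    move=> lj xT'; rewrite in_setU1 (subsetP (sU'P j)) ?orbT // inE.
    by rewrite (subsetP (sT'U' l)) // (disjointFr (dT' _ _ lj)).
  rewrite (parity_biclique (compatible_biclique bU bw j)) //.
  - exact: inUj cT'k.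
  - by rewrite eqw setU11.
  - exact: inUj vT'.
move=> i; split.
  by apply: biclique_sub (compatible_biclique bU bw i); apply: setUS.
move=> v vT'; have [j ji] := ord_neq i p_gt0; have [c _ cU'] := anchor' i j ji.
apply/nonbicliqueP; exists c, (w i), v; rewrite !in_setU1 !eqxx cU' /= !orbT; split=> //.
by have := incompatible_parity bU bw (subsetP (sTP i) v vT') (subsetP (sU'P i) c cU').
Qed.

End Large.

End BiocularExistence.

(** * Exceptional parameters and the cycle of implications *)

Section Equivalences.
Variables (G : sgraph) (p q : nat).
Hypotheses (p_gt0 : 0 < p) (q_gt0 : 0 < q).

(** For (2,1) only beta_1 is allowed, and an odd triple with its vertices as petals satisfies it. *)
Lemma biocular21_of_parity (x y z : G) : parity x y z ->
  exists (X : {set G}) H, biocular 2 1 0 H /\ sgraph_iso (induced X) H.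
Proof.
move=> par; have c3 := parity_card par.
pose e (i : 'I_3) := nth x [:: x; y; z] i; pose U := [set x; y; z].
have eU i : e i \in U.
  by case: i => [[|[|[|//]]] ?]; rewrite !inE eqxx ?orbT.
have e_inj : injective e.
  move=> i j /eqP; rewrite nth_uniq //; first by move/eqP/val_inj.
  by apply/card_uniqP; rewrite /= -c3; apply: eq_card => u; rewrite !inE orbA.
have nbU : ~~ biclique U.
  by apply/nonbicliqueP; exists x, y, z; rewrite !inE !eqxx !orbT.
apply: (biocular_of_subset (U := U) (W := set0) (T_ := fun i => [set e i])) => //.
- by rewrite disjoint_sym disjoints_subset sub0set.
- split=> [i|i|i j ij]; rewrite ?sub1set ?cards1 //.
  by rewrite disjoints1 inE (inj_eq e_inj).
left; split=> //; [by right| |by right] => i; split=> [|v].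
  by apply: biclique_card2; rewrite -ltnS; have := cardsD1 (e i) U; rewrite eU c3 => ->.
by rewrite inE => /eqP->; rewrite setD1K.
Qed.

Lemma biocular_of_critical : has_critical p q (max_bicliques G) ->
  exists2 s, s < q &
    exists (X : {set G}) H, biocular p q s H /\ sgraph_iso (induced X) H.
Proof.
move=> crit; case: (crit) => M /(parity_of_critical p_gt0)[x [y [z par]]].
have [p1|p_neq1] := eqVneq p 1.
  have [q1|q_neq1] := eqVneq q 1.
    by exists 0 => //; rewrite p1 q1; apply: small_biocular_of_parity par.
  have q_gt1 : 1 < q by rewrite ltn_neqAle eq_sym q_neq1.
  by move: crit; rewrite p1; apply: biocular1_of_critical.
have p_gt1 : 1 < p by rewrite ltn_neqAle eq_sym p_neq1.
have [/andP[/eqP p2 /eqP q1]|pq21] := boolP ((p == 2) && (q == 1)).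
  by exists 0 => //; rewrite p2 q1; apply: biocular21_of_parity par.
have [s [U [T_ [ltsq blU]]]] := blocked_of_critical p_gt0 q_gt0 crit.
have [bU|nbU] := boolP (biclique U).
  apply: (biocular_of_biclique p_gt1 ltsq blU) => // -[p2 q1].
  by rewrite p2 q1 in pq21.
have [p2 s0 nbT] := nonbiclique_flower p_gt1 blU nbU.
have [cU petals bT _] := blU; exists s => //.
apply: (biocular_of_subset (U := U) (W := set0) (T_ := T_)) => //.
- by rewrite (negPf p_neq1).
- by rewrite disjoint_sym disjoints_subset sub0set.
by left; split=> //; [right | move=> i; split=> // v; apply: nbT | right].
Qed.

(** Discarding an empty edge is harmless: each M_i contains some [others M j], which has at least q
    > 0 points. *)
Lemma max_bicliques_critical :
  has_critical p q (max_bicliques G) <->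
  has_critical p q (hedges (biclique_hypergraph G)).
Proof.
split=> -[M critM]; exists M => i; have [MG leq nsub] := critM i; split=> //.
  rewrite inE MG andbT inE -card_gt0 (leq_trans q_gt0) //.
  have [j ji] := ord_neq i p_gt0; have [_ leqj _] := critM j.
  by rewrite (leq_trans leqj) // subset_leq_card // others_sub // eq_sym.
by move: MG; rewrite inE => /andP[].
Qed.

End Equivalences.

Theorem theorem4p14 (p q : nat) (G : sgraph) (m n : nat) (B : 'M[nat]_(m, n)) :
  0 < p -> 0 < q -> biclique_matrix G B ->
  [<->
    (* (i) *)
    hereditary_biclique_Helly p q G;
    (* (ii) *)
    forall q', q <= q' -> biclique_Helly p q' G;
    (* (iii) *)
    strong_biclique_Helly p q G;
    (* (iv) *)
    forall F : {set {set G}},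
      F \subset max_bicliques G -> #|F| = p.+1 -> strong_pq_Helly p q F;
    (* (v) *)
    hereditary_p_Helly p (Phi q (biclique_hypergraph G));
    (* (vi) *)
    forall s, s < q ->
      ~ (exists (T : finType) (J : hypergraph T) (k l : nat)
                (N : 'M[nat]_(k, l)),
           [/\ is_J p.+1 q s J, incidence_matrix (hvert J) (hedges J) N
             & submatrix N B]);
    (* (vii) *)
    forall s, s < q ->
      forall (U : {set G}) (T_ : 'I_p.+1 -> {set G}),
        #|U| = p.+1 * (q - s) + s ->
        (forall i, T_ i \subset U) ->
        (forall i, #|T_ i| = q - s) ->
        pairwise_disjoint T_ ->
        (forall i, biclique (U :\: T_ i)) ->
        exists (i : 'I_p.+1) (v : G),
          v \in T_ i /\
          forall w : G, biclique (w |: (U :\: T_ i)) ->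
            biclique (v |: (w |: (U :\: T_ i)));
    (* (viii) *)
    forall s, s < q ->
      ~ (exists (X : {set G}) (H : sgraph),
           biocular p q s H /\ sgraph_iso (induced X) H)].
Proof.
move=> p_gt0 q_gt0 incB.
have strongP := @strong_of_not_critical _ p q (max_bicliques G) p_gt0.
tfae.
- move=> HG q' leq; apply: (strong_Helly leq); apply: strongP => crit.
  exact: not_hereditary_of_critical crit HG.
- move=> HG; apply: strongP => -[M /critical_not_Helly[q' leq]].
  by apply; apply: HG.
- by move=> strG F sF _; apply: strong_sub strG.
- move=> HG; apply: Phi_Helly_of_not_critical => //.
  move=> /(max_bicliques_critical G p_gt0 q_gt0)[M critM].
  apply: (critical_not_strong critM); apply: HG.
    exact: critical_family_sub critM.
  exact: card_critical_family critM.
- move=> HG s ltsq [T [J [k [l [N [isJ incN subN]]]]]].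
  apply: not_Phi_Helly_of_critical HG => //.
  apply/(max_bicliques_critical G p_gt0 q_gt0).
  exact: (critical_of_submatrix incB ltsq isJ incN subN).
- move=> HB s ltsq U T_ cU sTU cT dT bU.
  have [/existsP[i /existsP[v /andP[vT /forallP vP]]]|no] := boolP [exists i, exists v,
    (v \in T_ i) && [forall w, biclique (w |: (U :\: T_ i)) ==>
                               biclique (v |: (w |: (U :\: T_ i)))]].
    by exists i, v; split=> // w; apply/implyP.
  (* A failure of (vii) is a blocked flower and contradicts strongness. The submatrix that a failure
     of strongness produces may belong to another value s', so (vi) is needed for all of them. *)
  case: (@not_strong_of_blocked G p q s U T_ ltsq); last first.
    apply: strongP => /(submatrix_of_critical incB p_gt0 q_gt0)[s' lts'].
    exact: HB.
  split=> // i v vT; apply/existsP; apply: contraR no => /existsPn no.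
  apply/existsP; exists i; apply/existsP; exists v; rewrite vT; apply/forallP=> w.
  by have := no w; rewrite negb_and negbK implybE.
- move=> H7 s ltsq [X [H [bioH isoH]]].
  have [U [T_ [cU [sTU cT dT] bU blT]]] := blocked_of_biocular p_gt0 ltsq bioH isoH.
  have [i [v [vT vP]]] := H7 s ltsq U T_ cU sTU cT dT bU.
  by have [w /andP[/vP-> ]] := blT i v vT.
- move=> H8 X; apply: (strong_Helly (leqnn q)); apply: strong_of_not_critical => //.
  move=> /critical_of_induced/(biocular_of_critical p_gt0 q_gt0)[s ltsq].
  exact: H8.
Qed.
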